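(* Let $\alpha>-1$, let $\phi$ be an analytic self-map of $\mathbb{D}$ with $\phi(0)=0$, and let $\psi$ be analytic on $\mathbb{D}$ with a zero of order $m>0$ at the origin, such that $C_{\psi,\phi}$ is bounded on $L^2_a(dA_\alpha)$. Let $\hat\psi_m$ be the $m$-th Taylor coefficient of $\psi$ at $0$. Then $W(C_{\psi,\phi})$ contains the closed disc centred at the origin with radius $\dfrac{m!\,\Gamma(\alpha+2)}{\Gamma(m+\alpha+2)+m!\,\Gamma(\alpha+2)}|\hat\psi_m|$.
   Context: $\mathbb{D}$ is the open unit disc. $L^2_a(dA_\alpha)$ is the weighted Bergman space of analytic $f$ on $\mathbb{D}$ with $\int_{\mathbb{D}}|f|^2dA_\alpha<\infty$, $dA_{\alpha}(z)=(\alpha+1)(1-|z|^2)^{\alpha}dA(z)$, $dA$ normalized area measure. $C_{\psi,\phi}f=\psi\cdot(f\circ\phi)$. $W(T)=\{\langle Tf,f\rangle:\|f\|=1\}$. *)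

(* Defs.v *)
(* mathcomp-analysis (measure/integration) + real_closed complex. *)
From mathcomp Require Import all_boot all_algebra.
From mathcomp Require Import all_classical all_reals all_analysis.
From mathcomp Require Import complex.
Set Implicit Arguments. Unset Strict Implicit. Unset Printing Implicit Defensive.
Import GRing.Theory Num.Theory numFieldNormedType.Exports.
Local Open Scope classical_set_scope.
Local Open Scope ring_scope.

Section BergmanDefs.
Variable R : realType.

(* modulus of a complex number *)
Definition cmod (z : R[i]) : R := ComplexField.Normc.normc z.

(* the open unit disc *)
Definition udisc : set R[i] := [set z | cmod z < 1].

(* the power series sum_k a k (z - z0)^k converges to w *)
Definition series_to (a : nat -> R[i]) (z0 z w : R[i]) : Prop :=
  (fun n : nat => cmod (\sum_(k < n) a k * (z - z0) ^+ k - w)) @ \oo --> (0 : R).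

(* f is analytic on the set U: near every point of U it is given by a
   convergent power series *)
Definition analytic_on (U : set R[i]) (f : R[i] -> R[i]) : Prop :=
  forall z0, U z0 -> exists r : R, 0 < r /\
    [set z | cmod (z - z0) < r] `<=` U /\
    exists a : nat -> R[i], forall z, cmod (z - z0) < r -> series_to a z0 z (f z).

(* identification of R * R with C *)
Definition toC (p : R * R) : R[i] := Complex p.1 p.2.

(* Lebesgue measure on the plane *)
Definition leb2 := ((@lebesgue_measure R) \x (@lebesgue_measure R))%E.

Definition udisc2 : set (R * R) := [set p | udisc (toC p)].

(* density of dA_alpha = (alpha+1)(1-|z|^2)^alpha dA, dA = dx dy / pi *)
Definition wdens (alpha : R) (p : R * R) : R :=
  (alpha + 1) / pi * (1 - cmod (toC p) ^+ 2) `^ alpha.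

(* squared norm  int_D |f|^2 dA_alpha  (extended real) *)
Definition bnorm2 (alpha : R) (f : R[i] -> R[i]) : \bar R :=
  (\int[leb2]_(p in udisc2) (wdens alpha p * cmod (f (toC p)) ^+ 2)%:E)%E.

(* membership in L^2_a(dA_alpha) *)
Definition bergman (alpha : R) (f : R[i] -> R[i]) : Prop :=
  analytic_on udisc f /\ (bnorm2 alpha f < +oo)%E.

(* inner product <f, g> = int_D f conj(g) dA_alpha *)
Definition binner (alpha : R) (f g : R[i] -> R[i]) : R[i] :=
  Complex
    (Rintegral leb2 udisc2
       (fun p => wdens alpha p * complex.Re (f (toC p) * (g (toC p))^*)%C))
    (Rintegral leb2 udisc2
       (fun p => wdens alpha p * complex.Im (f (toC p) * (g (toC p))^*)%C)).

(* weighted composition operator C_{psi,phi} f = psi * (f o phi) *)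
Definition wcomp (psi phi f : R[i] -> R[i]) : R[i] -> R[i] :=
  fun z => psi z * f (phi z).

(* bounded operator C_{psi,phi} on L^2_a(dA_alpha) *)
Definition wcomp_bounded (alpha : R) (psi phi : R[i] -> R[i]) : Prop :=
  exists M : R, forall f, bergman alpha f ->
    bergman alpha (wcomp psi phi f) /\
    (bnorm2 alpha (wcomp psi phi f) <= M%:E * bnorm2 alpha f)%E.

(* numerical range of C_{psi,phi} on L^2_a(dA_alpha) *)
Definition numrange_wcomp (alpha : R) (psi phi : R[i] -> R[i]) : set R[i] :=
  [set binner alpha (wcomp psi phi f) f | f in
     [set f | bergman alpha f /\ bnorm2 alpha f = 1%:E]].

(* Euler Gamma function  Gamma(s) = int_0^oo t^(s-1) e^(-t) dt *)
Definition Gamma (s : R) : R :=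
  Rintegral (@lebesgue_measure R) `]0, +oo[
    (fun t => t `^ (s - 1) * expR (- t)).

End BergmanDefs.

(* Main.v *)
(** Test [W(C_{psi,phi})] on [f = a + b z^m].  Write [N_j] for [|z^j|^2].  Since
    [psi] has a zero of order [m] and [phi 0 = 0], the functions [psi],
    [psi phi^m], [psi phi^m conj(z)^m] integrate to [0], so
    [<Cf, f> = a conj(b) c_m N_m], while [|f|^2 = |a|^2 N_0 + |b|^2 N_m].
    Hence [W] contains the disc of radius [|c_m| sqrt(N_m / N_0) / 2], which by
    AM-GM is at least [|c_m| N_m / (N_0 + N_m)], the radius claimed.

    No polar coordinates are needed.  If [P' = W] on [t < 1] and [h] is
    holomorphic, then [(P(|z|^2) - P T) h] vanishes on [|z|^2 = T] and its
    d-bar derivative is [W(|z|^2) z h(z)], so Fubini and the fundamental theorem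
    of calculus on horizontal and vertical chords give
    [\int_{|z|^2 <= T} W(|z|^2) z h(z) = 0]; then let [T] tend to [1].  In the same way the
    divergence of [(P(|z|^2) - P T) z] integrates to [0], which yields
    [(j+1) N_j = (alpha+j+2) N_{j+1}], to be compared with
    [Gamma (s+1) = s Gamma s]. *)
Require Import Defs.
From mathcomp Require Import all_boot all_order all_algebra.
From mathcomp Require Import all_classical all_reals all_analysis.
From mathcomp Require Import measurable_realfun complex ring lra.
Set Implicit Arguments. Unset Strict Implicit. Unset Printing Implicit Defensive.
Import Order.TTheory GRing.Theory Num.Theory numFieldNormedType.Exports.
Local Open Scope classical_set_scope.
Local Open Scope ring_scope.

(** * The complex modulus *)

Section Cmod.
Variable R : realType.
Implicit Types z w : R[i].

(** Three obstacles shape the proof. Analyticity is given by a power series around each point, while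
    the divergence theorem needs one derivative, continuous on the whole disc: each series yields a
    second-order estimate in two points, and the local derivatives are then glued. The weight is
    unbounded at the circle when [alpha < 0], and [psi] is not controlled there; so every identity
    is first proved on [|z|^2 <= T] with [T < 1], where continuity is enough, and integrability over
    the whole disc is a separate task. For the products containing [psi] it comes from boundedness
    of the operator, applied to [1] and [z^m]. Finally, a real-valued integral says nothing without
    integrability, so the linearity lemmas carry integrability along with the value. For [Gamma]
    only nonnegativity and the functional equation are established; the comparison of radii is
    arranged so that these two facts suffice. *)

Lemma cmodM z w : cmod (z * w) = cmod z * cmod w.
Proof. exact: ComplexField.Normc.normcM. Qed.

Lemma cmodD z w : cmod (z + w) <= cmod z + cmod w.
Proof. exact: le_normcD. Qed.

Lemma cmodN z : cmod (- z) = cmod z.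
Proof. exact: normcN. Qed.

Lemma cmodB z w : cmod (z - w) <= cmod z + cmod w.
Proof. by rewrite -(cmodN w) cmodD. Qed.

Lemma cmodBC z w : cmod (z - w) = cmod (w - z).
Proof. by rewrite -cmodN opprB. Qed.

Lemma cmod0 : cmod (0 : R[i]) = 0.
Proof. exact: ComplexField.Normc.normc0. Qed.

Lemma cmod1 : cmod (1 : R[i]) = 1.
Proof. exact: ComplexField.Normc.normc1. Qed.

Lemma cmodV z : cmod z^-1 = (cmod z)^-1.
Proof. exact: ComplexField.Normc.normcV. Qed.

Lemma cmodX z n : cmod (z ^+ n) = cmod z ^+ n.
Proof. by elim: n => [|n IH]; rewrite ?expr0 ?cmod1// !exprS cmodM IH. Qed.

Lemma cmodE z : cmod z = Num.sqrt (complex.Re z ^+ 2 + complex.Im z ^+ 2).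
Proof. by case: z. Qed.

Lemma cmod_ge0 z : 0 <= cmod z.
Proof. by rewrite cmodE sqrtr_ge0. Qed.

Lemma sqr_cmod z : cmod z ^+ 2 = complex.Re z ^+ 2 + complex.Im z ^+ 2.
Proof. by rewrite cmodE sqr_sqrtr// addr_ge0// sqr_ge0. Qed.

Lemma cmod_eq0 z : (cmod z == 0) = (z == 0).
Proof.
apply/eqP/eqP => [|->]; last exact: cmod0.
exact: ComplexField.Normc.eq0_normc.
Qed.

Lemma cmod_gt0 z : (0 < cmod z) = (z != 0).
Proof. by rewrite lt_def cmod_ge0 andbT cmod_eq0. Qed.

Lemma Re_le_cmod z : `|complex.Re z| <= cmod z.
Proof.
rewrite -(@ler_pXn2r _ 2)// ?nnegrE ?cmod_ge0//.
by rewrite real_normK ?num_real// sqr_cmod lerDl sqr_ge0.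
Qed.

Lemma Im_le_cmod z : `|complex.Im z| <= cmod z.
Proof.
rewrite -(@ler_pXn2r _ 2)// ?nnegrE ?cmod_ge0//.
by rewrite real_normK ?num_real// sqr_cmod lerDr sqr_ge0.
Qed.

Lemma cmod_real (x : R) : cmod (x%:C)%C = `|x|.
Proof. by rewrite cmodE /= expr0n /= addr0 sqrtr_sqr. Qed.

Lemma cmod_im (x : R) : cmod (Complex 0 x) = `|x|.
Proof. by rewrite cmodE /= expr0n /= add0r sqrtr_sqr. Qed.

Lemma cmod_le_ReIm z : cmod z <= `|complex.Re z| + `|complex.Im z|.
Proof.
have -> : z = (complex.Re z)%:C%C + Complex 0 (complex.Im z).
  by case: z => a b; rewrite /= /real_complex_def /=; apply/eqP;
     rewrite eq_complex /= addr0 add0r !eqxx.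
by rewrite (le_trans (cmodD _ _))// cmod_real cmod_im /= ?addr0 ?add0r.
Qed.

Lemma cmod_nat n : cmod (n%:R : R[i]) = n%:R.
Proof.
have -> : (n%:R : R[i]) = (n%:R : R)%:C%C by rewrite rmorph_nat.
by rewrite cmod_real normr_nat.
Qed.

Lemma cmod_sum n (F : 'I_n -> R[i]) :
  cmod (\sum_(k < n) F k) <= \sum_(k < n) cmod (F k).
Proof.
elim: n F => [|n IH] F; first by rewrite !big_ord0 cmod0.
by rewrite !big_ord_recr /= (le_trans (cmodD _ _))// lerD2r.
Qed.

(** Convergence in the same form as in [series_to], which unfolds to it; statements about power
    series are thus used directly. *)
Definition cto (u : nat -> R[i]) (l : R[i]) :=
  (fun n => cmod (u n - l)) @ \oo --> (0 : R).

Lemma ctoP u l : cto u l <->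
  (forall e, 0 < e -> exists N, forall n, (N <= n)%N -> cmod (u n - l) < e).
Proof.
split=> [/cvgrPdist_lt h e e0|h].
  have [N _ hN] := h e e0; exists N => n Nn.
  by have := hN n Nn; rewrite /= sub0r normrN ger0_norm ?cmod_ge0.
apply/cvgrPdist_lt => e e0; have [N hN] := h e e0; exists N => // n /= Nn.
by rewrite sub0r normrN ger0_norm ?cmod_ge0// hN.
Qed.

Lemma cto_le u l K : cto u l -> (forall n, cmod (u n) <= K) -> cmod l <= K.
Proof.
move=> /ctoP ul uK; apply/ler_addgt0Pr => e e0.
have [N /(_ N (leqnn _)) h] := ul e e0.
have -> : l = u N - (u N - l) by rewrite opprB addrCA subrr addr0.
by rewrite (le_trans (cmodB _ _))// lerD// ltW.
Qed.

Lemma ctoD u v l m : cto u l -> cto v m -> cto (fun n => u n + v n) (l + m).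
Proof.
move=> /ctoP ul /ctoP vm; apply/ctoP => e e0.
have e2 : 0 < e / 2 by lra.
have [N1 h1] := ul _ e2; have [N2 h2] := vm _ e2.
exists (maxn N1 N2) => n; rewrite geq_max => /andP[/h1 ? /h2 ?].
have -> : u n + v n - (l + m) = (u n - l) + (v n - m) by ring.
by rewrite (le_lt_trans (cmodD _ _))//; lra.
Qed.

Lemma ctoMr u l c : cto u l -> cto (fun n => u n * c) (l * c).
Proof.
move=> /ctoP ul; apply/ctoP => e e0.
have c1 : 0 < cmod c + 1 by rewrite ltr_wpDl// cmod_ge0.
have [|N h] := ul (e / (cmod c + 1)); first exact: divr_gt0.
exists N => n /h; rewrite ltr_pdivlMr// => hn.
rewrite -mulrBl cmodM (le_lt_trans _ hn)// ler_wpM2l ?cmod_ge0//; lra.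
Qed.

Lemma cto_cst (N0 : nat) u l : (forall n, (N0 <= n)%N -> u n = l) -> cto u l.
Proof.
move=> h; apply/ctoP => e e0; exists N0 => n /h ->.
by rewrite subrr cmod0.
Qed.

Lemma cto_unique u l m : cto u l -> cto u m -> l = m.
Proof.
move=> /ctoP ul /ctoP um; apply/eqP; rewrite -subr_eq0 -cmod_eq0.
rewrite eq_le cmod_ge0 andbT; apply/ler_addgt0Pr => e e0; rewrite add0r.
have e2 : 0 < e / 2 by lra.
have [N1 h1] := ul _ e2; have [N2 h2] := um _ e2.
have {}h1 := h1 _ (leq_maxl N1 N2); have {}h2 := h2 _ (leq_maxr N1 N2).
set n := maxn N1 N2 in h1 h2.
have -> : l - m = (u n - m) - (u n - l) by ring.
by rewrite (le_trans (cmodB _ _))//; lra.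
Qed.

(** Completeness is taken from the reals: the real and imaginary parts are each dominated by a
    geometric series. *)
Lemma geometric_cto (b : nat -> R[i]) K :
  (forall k, cmod (b k) <= K * 2^-1 ^+ k) ->
  exists s, cto (fun n => \sum_(k < n) b k) s.
Proof.
move=> hb.
have half : `|2^-1 : R| < 1 by rewrite ger0_norm; lra.
have cv (g : nat -> R) : (forall k, `|g k| <= K * 2^-1 ^+ k) ->
    cvgn (series g).
  move=> hg; apply: normed_cvg.
  apply: (series_le_cvg _ _ hg) => [n|n|]; first exact: normr_ge0.
    by rewrite (le_trans _ (hg n)).
  exact: is_cvg_geometric_series.
have /cv c1 : forall k, `|complex.Re (b k)| <= K * 2^-1 ^+ k.
  by move=> k; rewrite (le_trans (Re_le_cmod _)).
have /cv c2 : forall k, `|complex.Im (b k)| <= K * 2^-1 ^+ k.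
  by move=> k; rewrite (le_trans (Im_le_cmod _)).
exists (Complex (limn (series (fun k => complex.Re (b k))))
                (limn (series (fun k => complex.Im (b k))))).
set l1 := limn _ in c1 *; set l2 := limn _ in c2 *.
have e n : \sum_(k < n) b k = Complex (series (fun k => complex.Re (b k)) n)
    (series (fun k => complex.Im (b k)) n).
  rewrite /series /= !big_mkord; elim: n => [|n IH]; first by rewrite !big_ord0.
  by rewrite !big_ord_recr /= IH; case: (b n).
apply: (@squeeze_cvgr _ _ _ _ (cst 0)
   (fun n => `|series (fun k => complex.Re (b k)) n - l1| +
             `|series (fun k => complex.Im (b k)) n - l2|)).
- near=> n; rewrite cmod_ge0 /= e.
  exact: (le_trans (cmod_le_ReIm _)).
- exact: cvg_cst.
- have -> : (0 : R) = `|l1 - l1| + `|l2 - l2| by rewrite !subrr normr0 addr0.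
  by apply: cvgD; apply: cvg_norm; apply: cvgB => //; exact: cvg_cst.
Unshelve. all: by end_near. Qed.

End Cmod.

(** * Quantitative complex differentiability *)

Section Holomorphic.
Variable R : realType.
Implicit Types (z w : R[i]) (f g d e : R[i] -> R[i]).

(* A second-order estimate uniform in both points forces [d] to be Lipschitz, so
   [f] is complex C^1 near [z0]; this avoids Cauchy's theory. *)
Definition holat d f z0 := exists rho C, [/\ 0 < rho, 0 <= C & forall z w,
  cmod (z - z0) < rho -> cmod (w - z0) < rho ->
  cmod (f z - f w - d w * (z - w)) <= C * cmod (z - w) ^+ 2].

(** Divide by the modulus of [z - z0] and let [z] approach [z0], here along a real displacement [s]
    with [s < rho] and [A * s <= t]. *)
Lemma cmod_mul_le_sqr_eq0 (e z0 : R[i]) (A rho : R) : 0 < rho -> 0 <= A ->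
  (forall z, cmod (z - z0) < rho ->
     cmod e * cmod (z - z0) <= A * cmod (z - z0) ^+ 2) -> e = 0.
Proof.
move=> rho0 A0 h; apply/eqP; rewrite -cmod_eq0 eq_le cmod_ge0 andbT.
apply/ler_addgt0Pr => t t0; rewrite add0r.
pose s := Num.min (rho / 2) (t / (A + 1)).
have A1 : 0 < A + 1 by lra.
have s0 : 0 < s by rewrite lt_min !divr_gt0.
have := h (z0 + s%:C%C); rewrite addrAC subrr add0r cmod_real gtr0_norm//.
have srho : s < rho by rewrite /s gt_min; apply/orP; left; lra.
move=> /(_ srho); rewrite expr2 mulrA ler_pM2r// => /le_trans; apply.
have : s <= t / (A + 1) by rewrite /s ge_min lexx orbT.
by rewrite ler_pdivlMr//; nra.
Qed.

(** Everything the product rule and the continuity arguments need, with a single constant: the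
    Lipschitz bound for [d] comes first, then the size of [d], the Lipschitz bound for [f] and the
    size of [f]. *)
Lemma holat_bounded d f z0 : holat d f z0 -> exists rho C, [/\ 0 < rho, 0 <= C,
  (forall z w, cmod (z - z0) < rho -> cmod (w - z0) < rho ->
  cmod (f z - f w - d w * (z - w)) <= C * cmod (z - w) ^+ 2),
  (forall z w, cmod (z - z0) < rho -> cmod (w - z0) < rho ->
    cmod (f z - f w) <= C * cmod (z - w) /\
    cmod (d z - d w) <= C * cmod (z - w)) &
  (forall z, cmod (z - z0) < rho -> cmod (f z) <= C /\ cmod (d z) <= C)].
Proof.
move=> [rho [C [rho0 C0 h]]].
have lipd z w : cmod (z - z0) < rho -> cmod (w - z0) < rho ->
    cmod (d z - d w) <= 2 * C * cmod (z - w).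
  move=> hz hw; have [->|zw] := eqVneq z w.
    by rewrite !subrr cmod0 mulr0.
  have zw0 : 0 < cmod (z - w) by rewrite cmod_gt0 subr_eq0.
  rewrite -(ler_pM2r zw0) -cmodM.
  (* The estimate is used at [(z, w)] and at [(w, z)]; in the sum the values of [f] cancel. *)
  have -> : (d z - d w) * (z - w) =
     (f z - f w - d w * (z - w)) + (f w - f z - d z * (w - z)) by ring.
  rewrite (le_trans (cmodD _ _))//.
  have := h _ _ hz hw; have := h _ _ hw hz; rewrite (cmodBC w z) !expr2; lra.
have z0in : cmod (z0 - z0) < rho by rewrite subrr cmod0.
have bd z : cmod (z - z0) < rho -> cmod (d z) <= cmod (d z0) + 2 * C * rho.
  move=> hz; have -> : d z = d z0 + (d z - d z0) by ring.
  rewrite (le_trans (cmodD _ _))// lerD2l (le_trans (lipd _ _ hz z0in))//.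
  by rewrite ler_wpM2l ?mulr_ge0// ltW.
pose D := cmod (d z0) + 2 * C * rho.
have D0 : 0 <= D by rewrite addr_ge0 ?cmod_ge0// !mulr_ge0// ltW.
have lipf z w : cmod (z - z0) < rho -> cmod (w - z0) < rho ->
    cmod (f z - f w) <= (2 * C * rho + D) * cmod (z - w).
  move=> hz hw.
  have -> : f z - f w = (f z - f w - d w * (z - w)) + d w * (z - w) by ring.
  rewrite (le_trans (cmodD _ _))// mulrDl lerD//.
    rewrite (le_trans (h _ _ hz hw))// expr2 mulrA ler_wpM2r ?cmod_ge0//.
    rewrite (mulrC 2) -mulrA ler_wpM2l//.
    have -> : z - w = (z - z0) - (w - z0) by ring.
    by rewrite (le_trans (cmodB _ _))//; lra.
  by rewrite cmodM ler_wpM2r ?cmod_ge0// bd.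
pose K := cmod (f z0) + (2 * C * rho + D) * rho.
have L0 : 0 <= 2 * C * rho + D by rewrite addr_ge0// !mulr_ge0// ltW.
have Cr0 : 0 <= 2 * C * rho by rewrite !mulr_ge0// ltW.
have K0 : 0 <= K by rewrite addr_ge0 ?cmod_ge0// mulr_ge0// ltW.
have bf z : cmod (z - z0) < rho -> cmod (f z) <= K.
  move=> hz; have -> : f z = f z0 + (f z - f z0) by ring.
  rewrite (le_trans (cmodD _ _))// lerD2l (le_trans (lipf _ _ hz z0in))//.
  by rewrite ler_wpM2l // ltW.
exists rho, (2 * C + 2 * C * rho + D + K); split => //.
- by lra.
- move=> z w hz hw; rewrite (le_trans (h _ _ hz hw))// ler_wpM2r ?exprn_ge0 ?cmod_ge0//; lra.
- move=> z w hz hw; split; [rewrite (le_trans (lipf _ _ hz hw))//|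
    rewrite (le_trans (lipd _ _ hz hw))//]; rewrite ler_wpM2r ?cmod_ge0//; lra.
- move=> z hz; split; [rewrite (le_trans (bf _ hz))//|rewrite (le_trans (bd _ hz))//].
    by lra.
  rewrite -/D; lra.
Qed.

Lemma holat_cst c z0 : holat (fun=> 0) (fun=> c) z0.
Proof.
by exists 1, 0; split => // z w _ _; rewrite !subrr mul0r subrr cmod0 mul0r.
Qed.

Lemma holat_id z0 : holat (fun=> 1) id z0.
Proof. by exists 1, 0; split => // z w _ _; rewrite mul1r subrr cmod0 mul0r. Qed.

Lemma holatD d e f g z0 : holat d f z0 -> holat e g z0 ->
  holat (fun z => d z + e z) (fun z => f z + g z) z0.
Proof.
move=> [r [C [r0 C0 h]]] [s [D [s0 D0 k]]].
exists (Num.min r s), (C + D); split; [by rewrite lt_min r0|by lra|].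
move=> z w; rewrite !lt_min => /andP[z1 z2] /andP[w1 w2].
have -> : f z + g z - (f w + g w) - (d w + e w) * (z - w) =
  (f z - f w - d w * (z - w)) + (g z - g w - e w * (z - w)) by ring.
by rewrite (le_trans (cmodD _ _))// mulrDl lerD ?h ?k.
Qed.

Lemma holatM d e f g z0 : holat d f z0 -> holat e g z0 ->
  holat (fun z => d z * g z + f z * e z) (fun z => f z * g z) z0.
Proof.
move=> /holat_bounded [r [C [r0 C0 h hl hb]]].
move=> /holat_bounded [s [D [s0 D0 k kl kb]]].
exists (Num.min r s), (3 * (C * D)); split.
- by rewrite lt_min r0.
- by rewrite !mulr_ge0.
move=> z w; rewrite !lt_min => /andP[z1 z2] /andP[w1 w2].
(* The three summands are the error of [f], the error of [g], and a product of two increments; each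
   is at most [C * D] times the squared distance, hence the constant [3 * (C * D)]. *)
have -> : f z * g z - f w * g w - (d w * g w + f w * e w) * (z - w) =
  (f z - f w - d w * (z - w)) * g w + f w * (g z - g w - e w * (z - w))
  + (f z - f w) * (g z - g w) by ring.
have t0 := cmod_ge0 (z - w).
have A1 : cmod ((f z - f w - d w * (z - w)) * g w) <= C * cmod (z - w) ^+ 2 * D.
  by rewrite cmodM ler_pM ?cmod_ge0 ?h//; have [] := kb _ w2.
have A2 : cmod (f w * (g z - g w - e w * (z - w))) <= C * (D * cmod (z - w) ^+ 2).
  by rewrite cmodM ler_pM ?cmod_ge0 ?k//; have [] := hb _ w1.
have A3 : cmod ((f z - f w) * (g z - g w)) <= C * cmod (z - w) * (D * cmod (z - w)).
  by rewrite cmodM ler_pM ?cmod_ge0//; [have [] := hl _ _ z1 w1|have [] := kl _ _ z2 w2].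
rewrite (le_trans (cmodD _ _))//.
rewrite (le_trans (lerD (le_trans (cmodD _ _) (lerD A1 A2)) A3))//.
by rewrite le_eqVlt; apply/orP; left; apply/eqP; ring.
Qed.

Lemma holatV z0 : z0 != 0 -> holat (fun z => - (z ^- 2)) (fun z => z^-1) z0.
Proof.
move=> z00; have c0 : 0 < cmod z0 by rewrite cmod_gt0.
(* The remainder is exactly [(z - w)^2 / (z * w^2)], and on this disc both points keep modulus at
   least [cmod z0 / 2]. *)
exists (cmod z0 / 2), ((cmod z0 / 2) ^- 3); split.
- by lra.
- by rewrite invr_ge0 exprn_ge0//; lra.
have far z : cmod (z - z0) < cmod z0 / 2 -> cmod z0 / 2 <= cmod z.
  move=> hz; have -> : cmod z0 = cmod (z - (z - z0)).
    by rewrite opprB addrCA subrr addr0.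
  have := cmodB z (z - z0); have -> : cmod (z - (z - z0)) = cmod z0.
    by rewrite opprB addrCA subrr addr0.
  lra.
move=> z w /far hz /far hw.
have cz : 0 < cmod z by lra.
have cw : 0 < cmod w by lra.
have nz : z != 0 by rewrite -cmod_gt0.
have nw : w != 0 by rewrite -cmod_gt0.
have -> : z^-1 - w^-1 - - w ^- 2 * (z - w) = (z - w) ^+ 2 * (z^-1 * w ^- 2).
  by field; rewrite nz nw.
rewrite cmodM !cmodX mulrC ler_wpM2r ?exprn_ge0 ?cmod_ge0//.
rewrite -invfM cmodV cmodM cmodX.
have c2 : 0 < cmod z0 / 2 by lra.
rewrite lef_pV2 ?posrE ?mulr_gt0 ?exprn_gt0//.
rewrite [X in X <= _]exprS ler_pM//; try lra.
  by rewrite exprn_ge0//; lra.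
by rewrite ler_pXn2r ?nnegrE//; lra.
Qed.

Lemma holat_ext d e f g z0 rho : 0 < rho ->
  (forall z, cmod (z - z0) < rho -> f z = g z /\ d z = e z) ->
  holat d f z0 -> holat e g z0.
Proof.
move=> rho0 h [r [C [r0 C0 k]]]; exists (Num.min r rho), C; split => //.
  by rewrite lt_min r0.
move=> z w; rewrite !lt_min => /andP[z1 /h[<- _]] /andP[w1 /h[<- <-]].
exact: k.
Qed.

Lemma holat_near d f z0 : holat d f z0 -> exists rho, 0 < rho /\
  forall w, cmod (w - z0) < rho -> holat d f w.
Proof.
move=> [r [C [r0 C0 h]]]; exists (r / 2); split; first by lra.
move=> w wz; exists (r / 2), C; split => //; first by lra.
move=> x y xw yw; apply: h.
  have -> : x - z0 = (x - w) + (w - z0) by ring.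
  by rewrite (le_lt_trans (cmodD _ _))//; lra.
have -> : y - z0 = (y - w) + (w - z0) by ring.
by rewrite (le_lt_trans (cmodD _ _))//; lra.
Qed.

Lemma holat_uniq d e f z0 : holat d f z0 -> holat e f z0 -> d z0 = e z0.
Proof.
move=> [r [C [r0 C0 h]]] [s [D [s0 D0 k]]].
apply/eqP; rewrite -subr_eq0; apply/eqP.
apply: (@cmod_mul_le_sqr_eq0 _ z0 (C + D) (Num.min r s)); [by rewrite lt_min r0|by lra|].
move=> z; rewrite lt_min => /andP[zr zs]; rewrite -cmodM.
have -> : (d z0 - e z0) * (z - z0) =
  (f z - f z0 - e z0 * (z - z0)) - (f z - f z0 - d z0 * (z - z0)) by ring.
have z0r : cmod (z0 - z0) < r by rewrite subrr cmod0.
have z0s : cmod (z0 - z0) < s by rewrite subrr cmod0.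
rewrite (le_trans (cmodB _ _))//.
by have := h _ _ zr z0r; have := k _ _ zs z0s; lra.
Qed.

Lemma udisc_ball z0 z : cmod (z - z0) < 1 - cmod z0 -> udisc z.
Proof.
rewrite /udisc /= => h; have -> : z = (z - z0) + z0 by ring.
by rewrite (le_lt_trans (cmodD _ _))//; lra.
Qed.

(** Each centre [z] comes with its own derivative [D z]. The diagonal [D z z] serves all centres: by
    [holat_near] and uniqueness, [D z0 z = D z z] for [z] near [z0]. *)
Lemma holat_glue f : (forall z0, udisc z0 -> exists d, holat d f z0) ->
  exists d, forall z0, udisc z0 -> holat d f z0.
Proof.
move=> h; have /choice[D hD] : forall z0, exists d, udisc z0 -> holat d f z0.
  by move=> z0; have [/h[d ?]|?] := pselect (udisc z0); [exists d|exists (fun=> 0)].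
exists (fun z => D z z) => z0 z0D.
have [r [r0 hr]] := holat_near (hD _ z0D).
apply: (@holat_ext (D z0) _ f _ z0 (Num.min r (1 - cmod z0))); last exact: hD.
  by rewrite lt_min r0 subr_gt0.
move=> z; rewrite lt_min => /andP[/hr zr /udisc_ball /hD zD]; split => //.
exact: holat_uniq zr zD.
Qed.

End Holomorphic.

(** * Power series and division by z *)

Section PowerSeries.
Variable R : realType.
Implicit Types (z w x y : R[i]) (f g d e : R[i] -> R[i]) (a : nat -> R[i]).

Lemma cto_bounded (u : nat -> R[i]) l : cto u l -> exists K, forall n, cmod (u n) <= K.
Proof.
move=> /ctoP /(_ 1 ltr01) [N hN].
have S0 n : 0 <= \sum_(k < n) cmod (u k) by apply: sumr_ge0 => k _; exact: cmod_ge0.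
exists (\sum_(k < N) cmod (u k) + (cmod l + 1)) => n.
have [nN|Nn] := ltnP n N.
  rewrite (bigD1 (Ordinal nN))//= -addrA lerDl addr_ge0//.
    by apply: sumr_ge0 => k _; exact: cmod_ge0.
  by rewrite addr_ge0// cmod_ge0.
rewrite ler_wpDl//; have -> : u n = l + (u n - l) by rewrite addrCA subrr addr0.
by rewrite (le_trans (cmodD _ _))// lerD2l ltW// hN.
Qed.

(** The factor [s ^+ 2] stands on the left to avoid the exponent [k - 2]. The crude [2 ^+ k] absorbs
    the polynomial growth in [k] and is paid for later by shrinking the radius. *)
Lemma expr_taylor2_le x y (s : R) k : cmod x <= s -> cmod y <= s ->
  s ^+ 2 * cmod (x ^+ k - y ^+ k - k%:R * y ^+ k.-1 * (x - y)) <=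
  (2 * s) ^+ k * cmod (x - y) ^+ 2.
Proof.
move=> xs ys; have s0 : 0 <= s by rewrite (le_trans (cmod_ge0 x)).
elim: k => [|k IH].
  by rewrite !expr0 subrr mul0r mul0r subrr cmod0 mulr0 mul1r exprn_ge0// cmod_ge0.
have -> : x ^+ k.+1 - y ^+ k.+1 - k.+1%:R * y ^+ k.+1.-1 * (x - y) =
  x * (x ^+ k - y ^+ k - k%:R * y ^+ k.-1 * (x - y)) +
  k%:R * y ^+ k.-1 * (x - y) ^+ 2.
  by case: k {IH} => [|k] /=; rewrite ?exprS -?natr1; ring.
rewrite (le_trans (ler_wpM2l _ (cmodD _ _))) ?exprn_ge0//.
rewrite mulrDr !cmodM !cmodX cmod_nat.
set t := cmod (x - y) in IH *; set E := cmod _ in IH *.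
have t0 : 0 <= t ^+ 2 by rewrite exprn_ge0// cmod_ge0.
have E0 : 0 <= s ^+ 2 * E by rewrite mulr_ge0 ?exprn_ge0 ?cmod_ge0.
have e1 : s ^+ 2 * (cmod x * E) <= s * ((2 * s) ^+ k * t ^+ 2).
  by rewrite mulrCA ler_pM ?cmod_ge0.
have e2 : s ^+ 2 * (k%:R * cmod y ^+ k.-1 * t ^+ 2) <= s * ((2 * s) ^+ k * t ^+ 2).
  case: k {IH E E0 e1} => [|k]; first by rewrite !mul0r mulr0 expr0 mul1r mulr_ge0.
  rewrite /= mulrA [leRHS]mulrA ler_wpM2r//.
  have yk : cmod y ^+ k <= s ^+ k by rewrite lerXn2r ?nnegrE ?cmod_ge0.
  have kk : k.+1%:R <= 2 ^+ k.+1 :> R by rewrite -natrX ler_nat ltnW// ltn_expl.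
  rewrite (_ : s * (2 * s) ^+ k.+1 = s ^+ 2 * (2 ^+ k.+1 * s ^+ k)); last first.
    by rewrite exprMn !exprS; ring.
  by rewrite ler_wpM2l ?exprn_ge0// ler_pM ?exprn_ge0 ?cmod_ge0.
rewrite (le_trans (lerD e1 e2))// le_eqVlt; apply/orP; left; apply/eqP.
by rewrite [(2 * s) ^+ k.+1]exprS; ring.
Qed.

Lemma sum_half_le n : \sum_(k < n) (2^-1 : R) ^+ k <= 2.
Proof.
have -> : \sum_(k < n) (2^-1 : R) ^+ k = 2 - 2 * 2^-1 ^+ n.
  elim: n => [|n IH]; first by rewrite big_ord0 expr0; lra.
  by rewrite big_ord_recr /= IH exprS; lra.
by rewrite gerBl mulr_ge0// exprn_ge0// invr_ge0.
Qed.

(** Termwise differentiation: all partial sums satisfy the second-order estimate with one constant,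
    and the estimate passes to the limit by [cto_le]. *)
Lemma holat_series a f z0 (r : R) : 0 < r ->
  (forall z, cmod (z - z0) < r -> series_to a z0 z (f z)) ->
  exists d, holat d f z0.
Proof.
move=> r0 h; pose s := r / 2; have s0 : 0 < s by rewrite /s; lra.
(* At the point at distance [s] a term is the difference of two consecutive partial sums, and these
   are bounded. *)
have [M hM] : exists M, forall k, cmod (a k) * s ^+ k <= M.
  have /cto_bounded[K hK] : cto (fun n => \sum_(k < n) a k * ((z0 + s%:C%C) - z0) ^+ k)
      (f (z0 + s%:C%C)).
    by apply: h; rewrite addrAC subrr add0r cmod_real gtr0_norm// /s; lra.
  exists (K + K) => k; rewrite -[s]gtr0_norm// -cmod_real -cmodX -cmodM.
  have := lerD (hK k.+1) (hK k); apply: le_trans; rewrite big_ord_recr /=.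
  rewrite addrAC subrr add0r.
  set S := \sum_(_ < _) _; set t := a k * _.
  have {1}-> : t = (S + t) - S by ring.
  exact: cmodB.
have M0 : 0 <= M by rewrite (le_trans _ (hM 0%N))// expr0 mulr1 cmod_ge0.
(* Since [2 * q = s / 2], the factor [2 ^+ k], coming from [k <= 2 ^+ k] or from the Taylor
   remainder, still leaves the decay [2^-1 ^+ k]. *)
pose q := s / 4; have q0 : 0 < q by rewrite /q; lra.
have bq k w : cmod (w - z0) <= q ->
    cmod (k%:R * a k * (w - z0) ^+ k.-1) <= M / q * 2^-1 ^+ k.
  move=> wq; rewrite -(ler_pM2r q0) [leRHS]mulrAC divfK ?gt_eqF// !cmodM cmod_nat cmodX.
  case: k => [|k]; first by rewrite !mul0r mulr_ge0 ?expr0.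
  have wk : cmod (w - z0) ^+ k <= q ^+ k by rewrite lerXn2r ?nnegrE ?cmod_ge0// ltW.
  have kk : k.+1%:R <= 2 ^+ k.+1 :> R by rewrite -natrX ler_nat ltnW// ltn_expl.
  apply: (@le_trans _ _ (2 ^+ k.+1 * cmod (a k.+1) * q ^+ k * q)).
    rewrite (ler_wpM2r (ltW q0))// ler_pM ?mulr_ge0 ?exprn_ge0 ?cmod_ge0//.
    by rewrite ler_wpM2r ?cmod_ge0.
  have -> : 2 ^+ k.+1 * cmod (a k.+1) * q ^+ k * q =
     (cmod (a k.+1) * s ^+ k.+1) * 2^-1 ^+ k.+1.
    rewrite -mulrA -exprSr mulrAC -exprMn -mulrA -exprMn mulrC.
    by congr (_ * _ ^+ _); rewrite /q; lra.
  by rewrite ler_wpM2r ?exprn_ge0 ?invr_ge0.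
have /choice[d hd] : forall w, exists l, cmod (w - z0) <= q ->
    cto (fun n => \sum_(k < n) k%:R * a k * (w - z0) ^+ k.-1) l.
  move=> w; have [wq|_] := boolP (cmod (w - z0) <= q); last by exists 0.
  by have [l hl] := geometric_cto (fun k => bq k w wq); exists l.
exists d, q, (2 * M / q ^+ 2); split; [exact: q0| |].
  by apply: divr_ge0; [exact: mulr_ge0|apply: exprn_ge0; exact: ltW].
move=> z w zq wq.
have qr : q < r by rewrite /q /s; lra.
have cz := h z (lt_trans zq qr); have cw := h w (lt_trans wq qr).
have := ctoD (ctoD cz (ctoMr (-1) cw)) (ctoMr (- (z - w)) (hd w (ltW wq))).
rewrite mulrN1 mulrN => /cto_le; apply => n.
rewrite !mulr_suml -!big_split /=.
under eq_bigr => k _.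
  rewrite (_ : _ + _ = a k * ((z - z0) ^+ k - (w - z0) ^+ k -
     k%:R * (w - z0) ^+ k.-1 * ((z - z0) - (w - z0)))); last by ring.
  over.
rewrite (le_trans (cmod_sum _))//.
have tt : (z - z0) - (w - z0) = z - w by ring.
apply: (@le_trans _ _ (\sum_(k < n) (M / q ^+ 2 * cmod (z - w) ^+ 2) * 2^-1 ^+ k)).
  apply: ler_sum => k _; rewrite cmodM.
  have q2 : 0 < q ^+ 2 by rewrite exprn_gt0.
  rewrite -(ler_pM2l q2) mulrCA.
  have := expr_taylor2_le k (ltW zq) (ltW wq).
  move=> /(ler_wpM2l (cmod_ge0 (a k))) /le_trans; apply.
  rewrite tt [leRHS](_ : _ = M * 2^-1 ^+ k * cmod (z - w) ^+ 2); last first.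
    by field; rewrite gt_eqF.
  rewrite mulrA ler_wpM2r ?exprn_ge0 ?cmod_ge0//.
  have -> : 2 * q = s * 2^-1 by rewrite /q; lra.
  by rewrite exprMn mulrA ler_wpM2r// exprn_ge0// invr_ge0.
rewrite -mulr_sumr (le_trans (ler_wpM2l _ (sum_half_le n)))//.
  apply: mulr_ge0; last by rewrite exprn_ge0 ?cmod_ge0.
  by apply: divr_ge0 => //; apply: exprn_ge0; exact: ltW.
by rewrite le_eqVlt; apply/orP; left; apply/eqP; ring.
Qed.

Definition holo f := exists d, forall z0, udisc z0 -> holat d f z0.

Lemma analytic_holo f : analytic_on (@udisc R) f -> holo f.
Proof.
move=> h; apply: holat_glue => z0 /h [r [r0 [_ [a ha]]]].
exact: holat_series r0 ha.
Qed.

Lemma holo_cst c : holo (fun=> c).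
Proof. by exists (fun=> 0) => z0 _; exact: holat_cst. Qed.

Lemma holo_id : holo id.
Proof. by exists (fun=> 1) => z0 _; exact: holat_id. Qed.

Lemma holoD f g : holo f -> holo g -> holo (fun z => f z + g z).
Proof. by move=> [d hd] [e he]; eexists => z0 z0D; apply: holatD; [exact: hd|exact: he]. Qed.

Lemma holoM f g : holo f -> holo g -> holo (fun z => f z * g z).
Proof. by move=> [d hd] [e he]; eexists => z0 z0D; apply: holatM; [exact: hd|exact: he]. Qed.

Lemma holoX f n : holo f -> holo (fun z => f z ^+ n).
Proof.
move=> hf; elim: n => [|n IH]; first by under eq_fun do rewrite expr0; exact: holo_cst.
by under eq_fun do rewrite exprS; exact: holoM.
Qed.

Definition series_near0 (c : nat -> R[i]) f :=
  exists r : R, 0 < r /\ forall z, cmod z < r -> series_to c 0 z (f z).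

Lemma series_near0_val c f : series_near0 c f -> f 0 = c 0%N.
Proof.
move=> [r [r0 h]]; apply: (@cto_unique _ _ _ _ (h 0 _)); first by rewrite cmod0.
apply: (@cto_cst _ 1) => -[//|n] _; rewrite big_ord_recl expr0 mulr1 big1 ?addr0//.
by move=> i _; rewrite subrr /= /bump expr0n mulr0.
Qed.

(** A removable singularity treated by series: near 0 the quotient is given by the shifted power
    series, so [holat_series] applies, and away from 0 it is the product of [f] with the inverse
    function. *)
Lemma holo_divz c f : holo f -> series_near0 c f -> c 0%N = 0 ->
  exists g, [/\ holo g, series_near0 (fun k => c k.+1) g &
    forall z, f z = z * g z].
Proof.
move=> [d hd] cf c0; have f0 := series_near0_val cf; rewrite c0 in f0.
have [r [r0 h]] := cf.
pose g z := if z == 0 then c 1%N else f z / z.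
have gf z : f z = z * g z.
  by rewrite /g; case: eqVneq => [->|z0]; rewrite ?mul0r// mulrC divfK.
have sg : forall z, cmod (z - 0) < r -> series_to (fun k => c k.+1) 0 z (g z).
  move=> z; rewrite subr0 => zr; rewrite /g; case: eqVneq => [->|z0].
    apply: (@cto_cst _ 1) => -[//|n] _; rewrite big_ord_recl expr0 mulr1 big1 ?addr0//.
    by move=> i _; rewrite subrr /= /bump expr0n mulr0.
  have /ctoP H := ctoMr z^-1 (h z zr); apply/ctoP => e /H [N hN].
  exists N => n Nn; have := hN n.+1 (leqW Nn).
  rewrite big_ord_recl /= c0 mul0r add0r mulr_suml.
  rewrite (eq_bigr (fun k : 'I_n => c k.+1 * (z - 0) ^+ k))// => k _.
  by rewrite /bump /= exprS subr0; field.
exists g; split => //; last by exists r; split => // z zr; apply: sg; rewrite subr0.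
apply: holat_glue => z0 z0D; have [->|z00] := eqVneq z0 0.
  exact: holat_series sg.
eexists; apply: (@holat_ext _ _ _ _ _ _ (cmod z0) _ _ (holatM (hd _ z0D) (holatV z00))).
  by rewrite cmod_gt0.
move=> z zz0; split; last by [].
rewrite /g; case: eqVneq zz0 => // ->.
by rewrite sub0r cmodN ltxx.
Qed.

Lemma holo_divzX m c f : holo f -> series_near0 c f -> (forall k, (k < m)%N -> c k = 0) ->
  exists g, [/\ holo g, series_near0 (fun k => c (m + k)%N) g &
    forall z, f z = z ^+ m * g z].
Proof.
elim: m c f => [|m IH] c f hf cf c0.
  by exists f; split => // z; rewrite expr0 mul1r.
have [g [hg cg fg]] := holo_divz hf cf (c0 0%N isT).
have [k [hk ck gk]] := IH _ g hg cg (fun k km => c0 k.+1 km).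
by exists k; split => // z; rewrite fg gk exprS mulrA.
Qed.

Lemma analytic_cst_addX (a b : R[i]) m : analytic_on (@udisc R) (fun z => a + b * z ^+ m).
Proof.
move=> z0 z0D; exists (1 - cmod z0); split; first by rewrite subr_gt0.
split; first by move=> z; exact: udisc_ball.
(* Binomial re-expansion around [z0]. For [k > m] the binomial coefficient vanishes, so the
   truncated subtraction [m - k] does no harm. *)
exists (fun k => (if k == 0%N then a else 0) + b * (z0 ^+ (m - k) *+ 'C(m, k))) => z _.
apply: (@cto_cst _ m.+1) => n mn.
rewrite -(subnKC mn) big_split_ord /= [X in _ + X]big1 ?addr0; last first.
  by move=> i _; rewrite bin_small ?mulr0n ?mulr0 ?addr0 ?mul0r// ?leq_addr.
under eq_bigr do rewrite mulrDl.
rewrite big_split /= big_ord_recl /= expr0 mulr1 big1 ?addr0; last first.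
  by move=> i _; rewrite mul0r.
congr (_ + _); have {2}-> : z = z0 + (z - z0) by ring.
rewrite exprDn mulr_sumr; apply: eq_bigr => i _.
by rewrite -mulrA mulrnAl.
Qed.

End PowerSeries.

(** * Discs in the plane *)

Section Plane.
Variable R : realType.
Local Notation RR := (measurableTypeR R * measurableTypeR R)%type.
Implicit Types (p : R * R) (U : set (R * R)) (g : R * R -> R).

Definition nsq p := p.1 ^+ 2 + p.2 ^+ 2.

Lemma nsq_ge0 p : 0 <= nsq p.
Proof. by rewrite addr_ge0 ?sqr_ge0. Qed.

Lemma cmod_toC p : cmod (toC p) ^+ 2 = nsq p.
Proof. by rewrite sqr_cmod. Qed.

Lemma udisc2E : @udisc2 R = [set p | nsq p < 1].
Proof.
apply/seteqP; split => p; rewrite /udisc2 /udisc /= -cmod_toC.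
  by move=> h; rewrite exprn_ilt1 ?cmod_ge0.
by rewrite expr_lt1 ?cmod_ge0.
Qed.

(** Measurability refers to the product sigma-algebra of two lines, so an open set is exhibited as a
    countable union of boxes with rational centres and sides [2 / (n + 1)]. *)
Lemma open_measurable2 U : open U -> measurable (U : set RR).
Proof.
move=> oU; pose B (n : nat) (a b : rat) : set (R * R) :=
  ball (ratr a : R) n.+1%:R^-1 `*` ball (ratr b : R) n.+1%:R^-1.
(* [F n a b] is the box when it fits inside [U] and is empty otherwise, so the union may run over
   all indices. *)
pose F n a b := B n a b `&` [set _ | B n a b `<=` U].
have -> : U = \bigcup_n \bigcup_a \bigcup_b F n a b.
  apply/seteqP; split => [x Ux|x [n _ [a _ [b _]]]]; last first.
    by case=> Bx; apply.
  have /nbhs_ballP[e /= e0 he] := open_nbhs_nbhs (conj oU Ux).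
  have e2 : 0 < e / 2 by rewrite divr_gt0.
  have [N _ hN] := near_infty_natSinv_lt (PosNum e2).
  have {hN}hN := hN N (leqnn N); rewrite /= in hN.
  have N0 : 0 < N.+1%:R^-1 :> R by rewrite invr_gt0 ltr0n.
  pose d : R := N.+1%:R^-1; have d0 : 0 < d by [].
  have de : d < e / 2 by [].
  have lt (t : R) : t - d < t + d by clear -d0; lra.
  have [a] := rat_in_itvoo (lt x.1).
  rewrite in_itv /= => /andP[a1 a2].
  have [b] := rat_in_itvoo (lt x.2).
  rewrite in_itv /= => /andP[b1 b2].
  exists N => //; exists a => //; exists b => //; split.
    by split; rewrite /= /ball /= ltr_norml -/d; apply/andP; split; clear -a1 a2 b1 b2; lra.
  move=> y [] /=; rewrite /ball /= !ltr_norml -/d => /andP[y1 y2] /andP[y3 y4].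
  apply: he; split; rewrite /= /ball /= ltr_norml; apply/andP;
    clear -a1 a2 b1 b2 y1 y2 y3 y4 de; split; lra.
apply: bigcupT_measurable => n; apply: bigcupT_measurable_rat => a.
apply: bigcupT_measurable_rat => b; apply: measurableI; last first.
  have [h|h] := pselect (B n a b `<=` U).
    by rewrite (_ : [set _ | _] = setT)//; apply/seteqP; split.
  by rewrite (_ : [set _ | _] = set0)//; apply/seteqP; split.
by apply: measurableX; apply: measurable_realfun.open_measurable; exact: ball_open.
Qed.

Lemma continuous_measurable2 U g : open U ->
  (forall p, U p -> {for p, continuous g}) -> measurable_fun (U : set RR) (g : RR -> R).
Proof.
move=> oU cg mU; apply: (measurability _ (@measurable_realfun.RGenOpens.measurableE R)) => //.
move=> _ [_ [a [b ->] <-]]; apply: open_measurable2.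
rewrite openE => p [Up /= gp]; apply: filterI.
  exact: open_nbhs_nbhs.
apply: (cg _ Up); apply: open_nbhs_nbhs; split; [exact: interval_open|exact: gp].
Qed.

Lemma continuous2_lip g p0 : (exists rho C, 0 < rho /\ forall p,
    cmod (toC p - toC p0) < rho -> `|g p - g p0| <= C * cmod (toC p - toC p0)) ->
  {for p0, continuous g}.
Proof.
move=> [rho [C [rho0 h]]]; apply/cvgrPdist_lt => e e0.
pose D := `|C| + 1; have D0 : 0 < D by rewrite ltr_wpDl.
pose t := Num.min rho (e / D); have t0 : 0 < t by rewrite lt_min rho0 divr_gt0.
have t2 : 0 < t / 2 by rewrite divr_gt0.
apply/(@nbhs_ballP R (R * R)%type p0); exists (t / 2) => //= p [/= p1 p2].
rewrite /ball /= in p1 p2.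
have pt : cmod (toC p - toC p0) < t.
  by rewrite (le_lt_trans (cmod_le_ReIm _))//= -!(distrC p0.1) -!(distrC p0.2); lra.
have [pr pe] : cmod (toC p - toC p0) < rho /\ cmod (toC p - toC p0) < e / D.
  by move: pt; rewrite lt_min => /andP[].
rewrite distrC (le_lt_trans (h _ pr))//.
move: pe; rewrite ltr_pdivlMr//; apply: le_lt_trans; rewrite mulrC.
by rewrite ler_wpM2l ?cmod_ge0// (le_trans (ler_norm _))// lerDl.
Qed.

Lemma continuous2_fst p : {for p, continuous (fun p : R * R => p.1)}.
Proof. exact: cvg_fst. Qed.

Lemma continuous2_snd p : {for p, continuous (fun p : R * R => p.2)}.
Proof. exact: cvg_snd. Qed.

Lemma nsq_continuous : continuous nsq.
Proof.
move=> p; apply: (@cvgD _ _ _ _ _ (fun p : R * R => p.1 ^+ 2)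
  (fun p : R * R => p.2 ^+ 2)).
  apply: (@continuous_comp _ _ _ fst (fun x : R => x ^+ 2)).
    exact: continuous2_fst.
  exact: exprn_continuous.
apply: (@continuous_comp _ _ _ snd (fun x : R => x ^+ 2)).
  exact: continuous2_snd.
exact: exprn_continuous.
Qed.

Lemma open_udisc2 : open (@udisc2 R).
Proof.
rewrite udisc2E; apply: (@open_comp _ _ nsq [set x | x < 1]).
  by move=> p _; exact: nsq_continuous.
exact: open_lt.
Qed.

Lemma measurable_udisc2 : measurable (@udisc2 R : set RR).
Proof. by apply: open_measurable2; exact: open_udisc2. Qed.

(* [T] is the square of the radius. *)
Definition cdisc (T : R) : set (R * R) := [set p | nsq p <= T].

Lemma closed_cdisc T : closed (cdisc T).
Proof.
apply: (@preimage_closed _ _ nsq [set x | x <= T]).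
  by move=> p _; exact: nsq_continuous.
exact: closed_le.
Qed.

Lemma measurable_cdisc T : measurable (cdisc T : set RR).
Proof.
rewrite -[cdisc T]setCK; apply: measurableC; apply: open_measurable2.
by apply: closed_openC; exact: closed_cdisc.
Qed.

Lemma cdisc_sub_square T : T <= 1 -> cdisc T `<=` `[-1, 1] `*` `[-1, 1].
Proof.
move=> T1 p; rewrite /cdisc /nsq /= => pT.
have := sqr_ge0 p.1; have := sqr_ge0 p.2.
by split; rewrite /= in_itv /= -ler_norml -(@ler_pXn2r _ 2) ?nnegrE// expr1n
  real_normK ?num_real//; lra.
Qed.

Lemma compact_cdisc T : T <= 1 -> compact (cdisc T).
Proof.
move=> T1; apply: (@subclosed_compact _ (cdisc T) _ _ _ (cdisc_sub_square T1)).
  exact: closed_cdisc.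
by apply: compact_setX; exact: segment_compact.
Qed.

Lemma leb2_square : (leb2 (`[(-1)%R, 1%R] `*` `[(-1)%R, 1%R] : set (R * R)) = 4%:E)%E.
Proof.
rewrite /leb2 product_measure1E//= lebesgue_measure_itv /= lte_fin.
rewrite ifT; last by lra.
by rewrite -!EFinD -EFinM; congr EFin; ring.
Qed.

Lemma leb2_udisc2 : (leb2 (@udisc2 R) <= 4%:E)%E.
Proof.
rewrite -leb2_square /leb2; apply: le_measure; rewrite ?inE.
- exact: measurable_udisc2.
- by apply: measurableX.
- rewrite udisc2E => p /= p1; apply: (@cdisc_sub_square 1) => //.
  exact: ltW.
Qed.

Lemma cdisc_sub T : T < 1 -> cdisc T `<=` @udisc2 R.
Proof. by move=> T1 p; rewrite udisc2E /= => /le_lt_trans; exact. Qed.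

(** A function continuous on the open disc is bounded on the compact disc [cdisc T], which has
    finite area. Weights that blow up at the unit circle are thereby covered. *)
Lemma integrable_cdisc T g : T < 1 ->
  (forall p, udisc2 p -> {for p, continuous g}) ->
  (@leb2 R).-integrable (cdisc T) (EFin \o g).
Proof.
move=> T1 cg; apply: measurable_bounded_integrable.
- exact: measurable_cdisc.
- apply: (@le_lt_trans _ _ 4%:E); last exact: ltry.
  apply: (le_trans _ leb2_udisc2); apply: le_measure; rewrite ?inE.
  + exact: measurable_cdisc.
  + exact: measurable_udisc2.
  + exact: cdisc_sub.
- apply: (measurable_funS measurable_udisc2 (cdisc_sub T1)).
  exact: (continuous_measurable2 open_udisc2 cg).
- have cK : {within cdisc T, continuous (g : R * R -> R^o)}.
    apply: continuous_in_subspaceT => p /set_mem /(cdisc_sub T1); exact: cg.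
  have /compact_bounded[M [_ mrt]] := continuous_compact cK (compact_cdisc (ltW T1)).
  by exists M; split; rewrite ?num_real // => ? ? ? ?; apply: mrt => //; eexists; eauto.
Qed.

End Plane.

(** * The divergence theorem on a disc *)

Section Divergence.
Variable R : realType.
Local Notation mu := (@lebesgue_measure R).
Implicit Types (p : R * R) (u v ux uy : R * R -> R).

(** A chord of the disc is empty, a single point, or a segment with both ends on the circle; in the
    last case the fundamental theorem of calculus sees only the two vanishing end values. *)
Lemma integral_slice_eq0 (v v' : R -> R) (s : R) :
  (forall x, x ^+ 2 <= s -> is_derive x 1 v (v' x)) ->
  (forall x, x ^+ 2 <= s -> {for x, continuous v'}) ->
  (forall x, x ^+ 2 = s -> v x = 0) ->
  (\int[mu]_(x in [set x | x ^+ 2 <= s]%R) (v' x)%:E = 0)%E.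
Proof.
move=> dv cv v0; have [s0|s0|s0] := ltgtP s 0.
- rewrite (_ : [set _ | _] = set0) ?integral_set0//.
  by apply/seteqP; split => // x /= xs; have := sqr_ge0 x; lra.
- pose a := Num.sqrt s; have a0 : 0 < a by rewrite sqrtr_gt0.
  have a2 : a ^+ 2 = s by rewrite sqr_sqrtr// ltW.
  have sE x : (x ^+ 2 <= s) = (- a <= x <= a).
    by rewrite -a2 -ler_norml -(@ler_pXn2r _ 2 isT `|x|) ?nnegrE ?normr_ge0 ?(ltW a0)//
        real_normK ?num_real.
  have -> : [set x : R | x ^+ 2 <= s] = `[- a, a]%classic.
    by apply/seteqP; split => x; rewrite /= in_itv /= sE.
  have cd x : x ^+ 2 <= s -> {for x, continuous v}.
    by move=> /dv h; apply/differentiable_continuous/derivable1_diffP; apply: ex_derive.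
  rewrite (@continuous_FTC2 _ _ v).
  + by rewrite !v0 ?sqrrN// subee.
  + by lra.
  + apply: continuous_in_subspaceT => x /set_mem; rewrite /= in_itv /= -sE; exact: cv.
  + split.
    * move=> x; rewrite in_itv /= => /andP[x1 x2].
      by apply: ex_derive; apply: dv; rewrite sE !ltW.
    * by apply: cvg_at_right_filter; apply: cd; rewrite sqrrN a2.
    * by apply: cvg_at_left_filter; apply: cd; rewrite a2.
  + move=> x; rewrite in_itv /= => /andP[x1 x2].
    by rewrite derive1E; apply: derive_val; apply: dv; rewrite sE !ltW.
- rewrite (_ : [set _ | _] = [set 0]) ?integral_set1//.
  apply/seteqP; split => x /=; rewrite s0; last by move=> ->; rewrite expr0n.
  by move=> h; apply/eqP; rewrite -sqrf_eq0 eq_le h sqr_ge0.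
Qed.

Lemma continuous_pairl (x y : R) : {for x, continuous (fun x : R => (x, y))}.
Proof. by apply: (@cvg_pair _ _ _ _ (nbhs x) (nbhs y)); [exact: cvg_id|exact: cvg_cst]. Qed.

Lemma continuous_pairr (x y : R) : {for y, continuous (fun y : R => (x, y))}.
Proof. by apply: (@cvg_pair _ _ _ _ (nbhs x) (nbhs y)); [exact: cvg_cst|exact: cvg_id]. Qed.

(** The horizontal half of the divergence theorem for a function vanishing on the boundary circle:
    by Fubini every chord contributes 0. *)
Lemma integral_cdisc_dx u ux T : T < 1 ->
  (forall p, udisc2 p -> is_derive p.1 1 (fun x => u (x, p.2)) (ux p)) ->
  (forall p, udisc2 p -> {for p, continuous ux}) ->
  (forall p, nsq p = T -> u p = 0) ->
  (\int[@leb2 R]_(p in cdisc T) (ux p)%:E = 0)%E.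
Proof.
move=> T1 du cu u0.
have iu : (@leb2 R).-integrable setT ((EFin \o ux) \_ (cdisc T)).
  have [+ _] := @integrable_mkcond _ _ R (mu \x mu)%E _ (EFin \o ux) (measurable_cdisc T).
  by apply; exact: (integrable_cdisc T1 cu).
rewrite integral_mkcond /leb2 -integral21_prod_meas1//; apply: integral0_eq => y _.
rewrite /fubini_G.
(* On the line at height [y], restriction to the disc becomes restriction to the chord
   [x^2 <= T - y^2]. *)
under eq_integral => x _.
  rewrite (_ : _ (x, y) =
    ((fun x => (ux (x, y))%:E) \_ [set x | x ^+ 2 <= T - y ^+ 2]) x); last first.
    by rewrite !patchE; congr (if _ then _ else _);
      apply/asbool_equiv_eq; rewrite /cdisc /nsq /= lerBrDr.
  over.
have sub x : x ^+ 2 <= T - y ^+ 2 -> udisc2 (x, y).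
  by rewrite lerBrDr => h; apply: (cdisc_sub T1).
rewrite -integral_mkcond; apply: (@integral_slice_eq0 (fun x => u (x, y))).
- by move=> x /sub; exact: du.
- move=> x /sub /cu cx; apply: (@continuous_comp _ _ _ (fun x => (x, y)) ux) => //.
  exact: continuous_pairl.
- by move=> x xT; apply: u0; rewrite /nsq /= xT subrK.
Qed.

Lemma integral_cdisc_dy u uy T : T < 1 ->
  (forall p, udisc2 p -> is_derive p.2 1 (fun y => u (p.1, y)) (uy p)) ->
  (forall p, udisc2 p -> {for p, continuous uy}) ->
  (forall p, nsq p = T -> u p = 0) ->
  (\int[@leb2 R]_(p in cdisc T) (uy p)%:E = 0)%E.
Proof.
move=> T1 du cu u0.
have iu : (@leb2 R).-integrable setT ((EFin \o uy) \_ (cdisc T)).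
    have [+ _] := @integrable_mkcond _ _ R (mu \x mu)%E _ (EFin \o uy) (measurable_cdisc T).
  by apply; exact: (integrable_cdisc T1 cu).
rewrite integral_mkcond /leb2 -integral12_prod_meas1//; apply: integral0_eq => x _.
rewrite /fubini_F.
under eq_integral => y _.
  rewrite (_ : _ (x, y) =
    ((fun y => (uy (x, y))%:E) \_ [set y | y ^+ 2 <= T - x ^+ 2]) y); last first.
    by rewrite !patchE; congr (if _ then _ else _);
      apply/asbool_equiv_eq; rewrite /cdisc /nsq /= lerBrDl.
  over.
have sub y : y ^+ 2 <= T - x ^+ 2 -> udisc2 (x, y).
  by rewrite lerBrDl => h; apply: (cdisc_sub T1).
rewrite -integral_mkcond; apply: (@integral_slice_eq0 (fun y => u (x, y))).
- by move=> y /sub; exact: du.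
- move=> y /sub /cu cx; apply: (@continuous_comp _ _ _ (fun y => (x, y)) uy) => //.
  exact: continuous_pairr.
- by move=> y yT; apply: u0; rewrite /nsq /= yT addrC subrK.
Qed.

End Divergence.

(** * Radial weights: vanishing integrals from a primitive of the weight *)

Section Radial.
Variable R : realType.
Implicit Types (p q : R * R) (f g u v ux uy : R * R -> R) (P W phi : R -> R).

Lemma is_derive_quad phi (x l : R) : (exists rho C, 0 < rho /\ forall h : R, `|h| < rho ->
    `|phi (x + h) - phi x - l * h| <= C * h ^+ 2) -> is_derive x 1 phi l.
Proof.
move=> [rho [C [rho0 H]]].
have cv : h^-1 *: (phi (h *: 1 + x) - phi x) @[h --> (0:R)^'] --> l.
  apply/cvgrPdist_lt => e e0.
  pose D := `|C| + 1; have D0 : 0 < D by rewrite ltr_wpDl.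
  pose t := Num.min rho (e / D); have t0 : 0 < t by rewrite lt_min rho0 divr_gt0.
  exists t => //= h; move=> ht h0; rewrite /ball /= sub0r normrN in ht.
  have h1 : 0 < `|h| by rewrite normr_gt0.
  have [hr he] : `|h| < rho /\ `|h| < e / D by move: ht; rewrite lt_min => /andP[].
  rewrite distrC -(ltr_pM2r h1) -normrM /GRing.scale /= mulr1.
  have -> : (h^-1 * (phi (h + x) - phi x) - l) * h = phi (x + h) - phi x - l * h.
    by rewrite mulrBl mulrAC mulVf// mul1r (addrC h).
  rewrite (le_lt_trans (H _ hr))//.
  rewrite -[h ^+ 2]ger0_norm ?sqr_ge0// normrX expr2 mulrA ltr_pM2r//.
  move: he; rewrite ltr_pdivlMr//; apply: le_lt_trans.
  by rewrite mulrC ler_wpM2l// (le_trans (ler_norm _))// lerDl.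
apply: DeriveDef; first by apply: cvgP cv.
exact: cvg_lim cv.
Qed.

Definition lipat (g : R[i] -> R[i]) z0 := exists rho C, 0 < rho /\ forall z,
  cmod (z - z0) < rho -> cmod (g z - g z0) <= C * cmod (z - z0).

Lemma holat_lip d (h : R[i] -> R[i]) z0 : holat d h z0 -> lipat h z0 /\ lipat d z0.
Proof.
move=> /holat_bounded[rho [C [rho0 C0 _ H _]]].
have z00 : cmod (z0 - z0) < rho by rewrite subrr cmod0.
by split; exists rho, C; split => // z zr; have [] := H _ _ zr z00.
Qed.

Lemma lipat_Re (g : R[i] -> R[i]) p : lipat g (toC p) ->
  {for p, continuous (fun q => complex.Re (g (toC q)))}.
Proof.
move=> [rho [C [rho0 H]]]; apply: continuous2_lip; exists rho, C; split => // q /H.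
apply: le_trans; rewrite (le_trans _ (Re_le_cmod _))//.
by case: (g (toC q)) => ? ?; case: (g (toC p)).
Qed.

Lemma lipat_Im (g : R[i] -> R[i]) p : lipat g (toC p) ->
  {for p, continuous (fun q => complex.Im (g (toC q)))}.
Proof.
move=> [rho [C [rho0 H]]]; apply: continuous2_lip; exists rho, C; split => // q /H.
apply: le_trans; rewrite (le_trans _ (Im_le_cmod _))//.
by case: (g (toC q)) => ? ?; case: (g (toC p)).
Qed.

Lemma holat_dx_Re d (h : R[i] -> R[i]) p : holat d h (toC p) ->
  is_derive p.1 1 (fun x => complex.Re (h (toC (x, p.2)))) (complex.Re (d (toC p))).
Proof.
move=> [rho [C [rho0 C0 H]]]; apply: is_derive_quad; exists rho, C; split => // t tr.
have e : toC (p.1 + t, p.2) - toC p = t%:C%C.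
  by apply/eqP; rewrite eq_complex /= subrr addrAC subrr add0r !eqxx.
have z1 : cmod (toC (p.1 + t, p.2) - toC p) < rho by rewrite e cmod_real.
have z2 : cmod (toC p - toC p) < rho by rewrite subrr cmod0.
have := H _ _ z1 z2; rewrite e cmod_real real_normK ?num_real//; apply: le_trans.
rewrite (le_trans _ (Re_le_cmod _))// -surjective_pairing.
case: (h (toC (p.1 + t, p.2))) => a b; case: (h (toC p)) => a' b'.
by case: (d (toC p)) => x y; rewrite /= mulr0 subr0.
Qed.

(** A vertical step multiplies the derivative by [i], and [Im (i d) = Re d]. With [holat_dx_Re] this
    is the Cauchy-Riemann equation equating the x-derivative of [Re h] and the y-derivative of
    [Im h]. *)
Lemma holat_dy_Im d (h : R[i] -> R[i]) p : holat d h (toC p) ->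
  is_derive p.2 1 (fun y => complex.Im (h (toC (p.1, y)))) (complex.Re (d (toC p))).
Proof.
move=> [rho [C [rho0 C0 H]]]; apply: is_derive_quad; exists rho, C; split => // t tr.
have e : toC (p.1, p.2 + t) - toC p = Complex 0 t.
  by apply/eqP; rewrite eq_complex /= subrr addrAC subrr add0r !eqxx.
have z1 : cmod (toC (p.1, p.2 + t) - toC p) < rho by rewrite e cmod_im.
have z2 : cmod (toC p - toC p) < rho by rewrite subrr cmod0.
have := H _ _ z1 z2; rewrite e cmod_im real_normK ?num_real//; apply: le_trans.
rewrite (le_trans _ (Im_le_cmod _))// -surjective_pairing.
case: (h (toC (p.1, p.2 + t))) => a b; case: (h (toC p)) => a' b'.
by case: (d (toC p)) => x y; rewrite /= mulr0 addr0.
Qed.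

Lemma continuousM_at (X : topologicalType) (f g : X -> R) (p : X) : {for p, continuous f}
    -> {for p, continuous g} ->
  {for p, continuous (fun x => f x * g x)}.
Proof. by move=> cf cg; exact: (cvgM cf cg). Qed.

Lemma continuousD_at (X : topologicalType) (f g : X -> R) (p : X) : {for p, continuous f}
    -> {for p, continuous g} ->
  {for p, continuous (fun x => f x + g x)}.
Proof. by move=> cf cg; exact: (cvgD cf cg). Qed.

Lemma continuousN_at (X : topologicalType) (f : X -> R) (p : X) : {for p, continuous f} ->
  {for p, continuous (fun x => - f x)}.
Proof. by move=> cf; exact: (cvgN cf). Qed.

Lemma continuous_cst_at (X : topologicalType) (c : R) (p : X) : {for p, continuous (fun=> c : R)}.
Proof. exact: cvg_cst. Qed.

Lemma continuous_comp_nsq phi p : {for nsq p, continuous phi} ->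
  {for p, continuous (fun q => phi (nsq q))}.
Proof.
by move=> cphi; apply: (@continuous_comp _ _ _ (@nsq R) phi) => //; exact: nsq_continuous.
Qed.

Section Primitive.
Variables P W : R -> R.
Hypothesis dP : forall t : R, t < 1 -> is_derive t 1 P (W t).
Hypothesis cW : forall t : R, t < 1 -> {for t, continuous W}.

Let cP (t : R) : t < 1 -> {for t, continuous P}.
Proof.
by move=> /dP h; apply/differentiable_continuous/derivable1_diffP; apply: ex_derive.
Qed.

(** The division by 2 cancels the 2 from differentiating [nsq]; [c] will be [P T], which makes the
    function vanish on the circle. *)
Let dPx p (c : R) : udisc2 p ->
  is_derive p.1 1 (fun x => (P (nsq (x, p.2)) - c) / 2) (p.1 * W (nsq p)).
Proof.
rewrite udisc2E /= => p1.
have h : is_derive p.1 1 (fun x : R => nsq (x, p.2)) (2 * p.1).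
  rewrite /nsq /=; apply: is_derive_eq.
  by rewrite /GRing.scale /=; ring.
have k : is_derive (nsq (p.1, p.2)) 1 P (W (nsq p)).
  by rewrite -surjective_pairing; exact: dP.
have := @is_derive1_comp _ P (fun x : R => nsq (x, p.2)) p.1 _ _ k h.
rewrite /comp => {}k.
by apply: is_derive_eq; rewrite /GRing.scale /=; field.
Qed.

Let dPy p (c : R) : udisc2 p ->
  is_derive p.2 1 (fun y => (P (nsq (p.1, y)) - c) / 2) (p.2 * W (nsq p)).
Proof.
rewrite udisc2E /= => p1.
have h : is_derive p.2 1 (fun y : R => nsq (p.1, y)) (2 * p.2).
  rewrite /nsq /=; apply: is_derive_eq.
  by rewrite /GRing.scale /=; ring.
have k : is_derive (nsq (p.1, p.2)) 1 P (W (nsq p)).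
  by rewrite -surjective_pairing; exact: dP.
have := @is_derive1_comp _ P (fun y : R => nsq (p.1, y)) p.2 _ _ k h.
rewrite /comp => {}k.
by apply: is_derive_eq; rewrite /GRing.scale /=; field.
Qed.

Let cPc p (c : R) : udisc2 p -> {for p, continuous (fun q => (P (nsq q) - c) / 2)}.
Proof.
rewrite udisc2E => /= p1; apply: continuousM_at; last exact: continuous_cst_at.
by apply: continuousD_at; [exact/continuous_comp_nsq/cP|exact: continuous_cst_at].
Qed.

Let cWn p : udisc2 p -> {for p, continuous (fun q => W (nsq q))}.
Proof. by rewrite udisc2E => /= p1; exact/continuous_comp_nsq/cW. Qed.

(** In real terms, subtract the y-derivative of [V * Im h] from the x-derivative of [V * Re h]: the
    two terms with [V] cancel by Cauchy-Riemann, and [W * (x Re h - y Im h) = W * Re (z h)]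
    remains. *)
Lemma integral_radial_holo (h : R[i] -> R[i]) T : T < 1 -> holo h ->
  (\int[@leb2 R]_(p in cdisc T) (W (nsq p) * complex.Re (toC p * h (toC p)))%:E = 0)%E.
Proof.
move=> T1 [d hd].
pose V p := (P (nsq p) - P T) / 2.
pose ux p := p.1 * W (nsq p) * complex.Re (h (toC p)) + V p * complex.Re (d (toC p)).
pose vy p := p.2 * W (nsq p) * complex.Im (h (toC p)) + V p * complex.Re (d (toC p)).
have cux p : udisc2 p -> {for p, continuous ux}.
  move=> pD; have [ch cd] := holat_lip (hd _ pD).
  apply: continuousD_at; apply: continuousM_at.
  - by apply: continuousM_at; [exact: continuous2_fst|exact: cWn].
  - exact: lipat_Re.
  - exact: cPc.
  - exact: lipat_Re.
have cvy p : udisc2 p -> {for p, continuous vy}.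
  move=> pD; have [ch cd] := holat_lip (hd _ pD).
  apply: continuousD_at; apply: continuousM_at.
  - by apply: continuousM_at; [exact: continuous2_snd|exact: cWn].
  - exact: lipat_Im.
  - exact: cPc.
  - exact: lipat_Re.
have V0 p : nsq p = T -> V p = 0 by rewrite /V => ->; rewrite subrr mul0r.
under eq_integral => p _.
  rewrite (_ : (_ * _)%:E = (ux p)%:E - (vy p)%:E)%E; last first.
    rewrite -EFinB /ux /vy; congr EFin.
    by case: p => x y; case: (h _) => a b; rewrite /toC /=; ring.
  over.
have Hx : (\int[@leb2 R]_(p in cdisc T) (ux p)%:E = 0)%E.
  apply: (@integral_cdisc_dx _ (fun p => V p * complex.Re (h (toC p)))) => //.
    move=> p pD; have h1 := dPx (P T) pD; have h2 := holat_dx_Re (hd _ pD).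
    by apply: is_derive_eq; rewrite /ux /GRing.scale /= -surjective_pairing; ring.
  by move=> p /V0 ->; rewrite mul0r.
have Hy : (\int[@leb2 R]_(p in cdisc T) (vy p)%:E = 0)%E.
  apply: (@integral_cdisc_dy _ (fun p => V p * complex.Im (h (toC p)))) => //.
    move=> p pD; have h1 := dPy (P T) pD; have h2 := holat_dy_Im (hd _ pD).
    by apply: is_derive_eq; rewrite /vy /GRing.scale /= -surjective_pairing; ring.
  by move=> p /V0 ->; rewrite mul0r.
rewrite /leb2 in Hx Hy *; rewrite integralB_EFin ?Hx ?Hy ?sube0//.
- exact: measurable_cdisc.
- exact: (integrable_cdisc T1 cux).
- exact: (integrable_cdisc T1 cvy).
Qed.

(** The integrand is the divergence of the field [V * (x, y)], namely [2 V + |z|^2 W]. *)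
Lemma integral_radial_euler T : T < 1 ->
  (\int[@leb2 R]_(p in cdisc T) (P (nsq p) - P T + nsq p * W (nsq p))%:E = 0)%E.
Proof.
move=> T1.
pose V p := (P (nsq p) - P T) / 2.
pose ux p := p.1 * W (nsq p) * p.1 + V p.
pose vy p := p.2 * W (nsq p) * p.2 + V p.
have cux p : udisc2 p -> {for p, continuous ux}.
  move=> pD; apply: continuousD_at; last exact: cPc.
  apply: continuousM_at; last exact: continuous2_fst.
  by apply: continuousM_at; [exact: continuous2_fst|exact: cWn].
have cvy p : udisc2 p -> {for p, continuous vy}.
  move=> pD; apply: continuousD_at; last exact: cPc.
  apply: continuousM_at; last exact: continuous2_snd.
  by apply: continuousM_at; [exact: continuous2_snd|exact: cWn].
have V0 p : nsq p = T -> V p = 0 by rewrite /V => ->; rewrite subrr mul0r.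
under eq_integral => p _.
  rewrite (_ : (_ + _)%:E = (ux p)%:E + (vy p)%:E)%E; last first.
    by rewrite -EFinD /ux /vy /V; congr EFin; rewrite {2}/nsq; field.
  over.
have Hx : (\int[@leb2 R]_(p in cdisc T) (ux p)%:E = 0)%E.
  apply: (@integral_cdisc_dx _ (fun p => V p * p.1)) => //.
    move=> p pD; have h1 := dPx (P T) pD.
    by apply: is_derive_eq; rewrite /ux /V /GRing.scale /= -surjective_pairing; ring.
  by move=> p /V0 ->; rewrite mul0r.
have Hy : (\int[@leb2 R]_(p in cdisc T) (vy p)%:E = 0)%E.
  apply: (@integral_cdisc_dy _ (fun p => V p * p.2)) => //.
    move=> p pD; have h1 := dPy (P T) pD.
    by apply: is_derive_eq; rewrite /vy /V /GRing.scale /= -surjective_pairing; ring.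
  by move=> p /V0 ->; rewrite mul0r.
rewrite /leb2 in Hx Hy *; rewrite integralD_EFin ?Hx ?Hy ?adde0//.
- exact: measurable_cdisc.
- exact: (integrable_cdisc T1 cux).
- exact: (integrable_cdisc T1 cvy).
Qed.

End Primitive.
End Radial.

(** * Moments of the radial weight *)

Section Weights.
Variable R : realType.
Local Notation mu := (@lebesgue_measure R).
Local Notation nu := (mu \x mu)%E.
Local Notation D := (@udisc2 R).
Implicit Types (p q : R * R) (f g : R * R -> R).

(** The variable [t] stands for [|z|^2]: up to the constant of the density, this is the integrand of
    the squared norm of [z^j]. *)
Definition rweight (a : R) (j : nat) (t : R) : R := (1 - t) `^ a * t ^+ j.

Lemma is_derive_onem_powR (a t : R) : t < 1 ->
  is_derive t 1 (fun t => (1 - t) `^ a) (- (a * (1 - t) `^ (a - 1))).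
Proof.
move=> t1; have t0 : 0 < 1 - t by rewrite subr_gt0.
have h : is_derive t 1 (fun t : R => 1 - t) (-1).
  by apply: is_derive_eq; ring.
have k := @is_derive1_powR R a _ t0.
have := @is_derive1_comp _ (fun x => x `^ a) (fun t : R => 1 - t) t _ _ k h.
by rewrite mulrN1.
Qed.

Lemma rweight_continuous a j t : t < 1 -> {for t, continuous (rweight a j)}.
Proof.
move=> t1; have h := is_derive_onem_powR a t1.
have c1 : {for t, continuous (fun t : R => (1 - t) `^ a)}.
  by apply/differentiable_continuous/derivable1_diffP; apply: ex_derive.
exact: (cvgM c1 (@exprn_continuous R j t)).
Qed.

Lemma rweight_ge0 a j t : 0 <= t -> 0 <= rweight a j t.
Proof. by move=> t0; rewrite mulr_ge0 ?powR_ge0 ?exprn_ge0. Qed.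

Lemma is_derive_rweight (a t : R) j : t < 1 ->
  is_derive t 1 (rweight (a + 1) j)
    (j%:R * ((1 - t) `^ (a + 1) * t ^+ j.-1) - (a + 1) * rweight a j t).
Proof.
move=> t1; have := is_derive_onem_powR (a + 1) t1; rewrite addrK => h.
have k : is_derive t 1 (fun t : R => t ^+ j) (j%:R * t ^+ j.-1).
  case: j => [|j]; first by under eq_fun do rewrite expr0; apply: is_derive_eq; rewrite mul0r.
  elim: j => [|j IH]; first by under eq_fun do rewrite expr1; apply: is_derive_eq; rewrite mulr1.
  under eq_fun do rewrite exprS; apply: is_derive_eq.
  by rewrite /GRing.scale /= exprS -!natr1; ring.
by rewrite /rweight; apply: is_derive_eq; rewrite /GRing.scale /=; ring.
Qed.

Lemma onem_powR1 (a t : R) : t < 1 -> (1 - t) `^ (a + 1) = (1 - t) `^ a * (1 - t).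
Proof.
move=> t1; have t0 : 0 < 1 - t by rewrite subr_gt0.
have h : (a + 1 == 0) ==> (1 - t != 0) by rewrite (gt_eqF t0) implybT.
by rewrite (powRD h) powRr1// ltW.
Qed.

(** The primitive is found by recursion on [j] through integration by parts, so it is explicit on
    the whole half-line [t < 1]. *)
Lemma rweight_primitive (a : R) j : -1 < a ->
  exists P : R -> R, forall t : R, t < 1 -> is_derive t 1 P (rweight a j t).
Proof.
move=> a1; elim: j => [|j [P hP]].
  have a0 : a + 1 != 0 by rewrite gt_eqF//; lra.
  exists (fun t => - (a + 1)^-1 * rweight (a + 1) 0 t) => t t1.
  have h := is_derive_rweight a 0 t1.
  by apply: is_derive_eq; rewrite /GRing.scale /=; field.
have a0 : a + j.+2%:R != 0.
  by rewrite gt_eqF// -natr1 -natr1; have := ler0n R j; lra.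
(* Solved from: the derivative of [rweight (a + 1) j.+1] is [(j + 1) rweight a j - (a + j + 2)
   rweight a j.+1]. *)
exists (fun t => (a + j.+2%:R)^-1 * (j.+1%:R * P t - rweight (a + 1) j.+1 t)) => t t1.
have h := is_derive_rweight a j.+1 t1; have k := hP t t1.
apply: is_derive_eq; rewrite /GRing.scale /= /rweight onem_powR1//= exprS.
by rewrite -!natr1 in a0 *; field.
Qed.

Lemma continuous_rweight_nsq a j p : D p -> {for p, continuous (fun q => rweight a j (nsq q))}.
Proof. by rewrite udisc2E => /= p1; apply: continuous_comp_nsq; exact: rweight_continuous. Qed.

Lemma measurable_rweight a j : measurable_fun (D : set (measurableTypeR R * measurableTypeR
    R)) (fun q => rweight a j (nsq q)).
Proof. by apply: (continuous_measurable2 (@open_udisc2 R)); exact: continuous_rweight_nsq. Qed.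

(** Squared radii of an exhausting sequence of closed discs; they start at 0 and stay below 1. *)
Definition drad (n : nat) : R := 1 - n.+1%:R^-1.

Lemma drad_lt1 n : drad n < 1.
Proof. by rewrite /drad ltrBlDr ltrDl invr_gt0. Qed.

Lemma drad_ge0 n : 0 <= drad n.
Proof. by rewrite /drad subr_ge0 invf_le1// ler1n. Qed.

Lemma drad_cvg (r : R) : r < 1 -> \forall n \near \oo, r <= drad n.
Proof.
move=> r1; have e0 : 0 < 1 - r by rewrite subr_gt0.
have := near_infty_natSinv_lt (PosNum e0); apply: filterS => n /= h.
by rewrite /drad lerBrDr addrC -lerBrDr ltW.
Qed.

Lemma cdisc_homo : {homo (fun n => cdisc (drad n)) : n m / (n <= m)%N >-> (n <= m)%O}.
Proof.
move=> n m nm; rewrite subsetEset => p /= /le_trans; apply.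
by rewrite /drad lerD2l lerN2 lef_pV2 ?posrE// ler_nat.
Qed.

Lemma bigcup_cdisc : \bigcup_n cdisc (drad n) = D.
Proof.
apply/seteqP; split => [p [n _]|p].
  exact: cdisc_sub (drad_lt1 n) _.
rewrite udisc2E /= => /drad_cvg[N _ hN]; exists N => //; exact: hN (leqnn N).
Qed.

(** Dominated convergence with bound [|g|]: at each point of the open disc the truncations
    eventually equal [g]. *)
Lemma integral_disc_lim g : nu.-integrable D (EFin \o g) ->
  (fun n => (\int[nu]_(p in cdisc (drad n)) (g p))%R) @ \oo --> (\int[nu]_(p in D) (g p))%R.
Proof.
move=> ig.
have mg : measurable_fun (D : set (measurableTypeR R * measurableTypeR R)) g.
  by apply/measurable_EFinP; exact: measurable_int ig.
have sub n : cdisc (drad n) `<=` D by apply: cdisc_sub; exact: drad_lt1.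
have e n : (\int[nu]_(p in cdisc (drad n)) (g p)%:E =
    \int[nu]_(p in D) (g p * \1_(cdisc (drad n)) p)%:E)%E.
  rewrite -(setIidr (sub n)) integral_mkcondr; apply: eq_integral => p /set_mem pD.
  rewrite patchE indicE; have -> : (p \in D `&` cdisc (drad n)) = (p \in cdisc (drad n)).
    by rewrite in_setI mem_set.
  by case: ifPn => _; rewrite ?mulr1 ?mulr0.
apply: fine_cvg; rewrite fineK; last exact: (integrable_fin_num (@measurable_udisc2 R) ig).
under eq_cvg do rewrite e.
have [] // := @dominated_convergence _ _ _ nu D (@measurable_udisc2 R)
  (fun n p => (g p * \1_(cdisc (drad n)) p)%:E) (EFin \o g) (abse \o (EFin \o g)).
- move=> n; apply/measurable_EFinP; apply: measurable_funM => //.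
  by apply: measurable_indic; exact: measurable_cdisc.
- exact/measurable_EFinP.
- apply: aeW => p Dp; have p1 : nsq p < 1 by move: Dp; rewrite udisc2E.
  apply: cvg_near_cst; have := drad_cvg p1; apply: filterS => n hn.
  by rewrite indicE mem_set ?mulr1.
- exact: integrable_abse.
- apply: aeW => p n Dp; rewrite /= lee_fin normrM indicE.
  by case: (p \in _); rewrite ?normr1 ?normr0 ?mulr1 ?mulr0.
Qed.

End Weights.

(** * Recurrence, finiteness and positivity of the moments *)

Section Moments.
Variable R : realType.
Local Notation mu := (@lebesgue_measure R).
Local Notation nu := (mu \x mu)%E.
Local Notation D := (@udisc2 R).
Local Notation RR := (measurableTypeR R * measurableTypeR R)%type.
Implicit Types (p q : R * R) (f g : R * R -> R).

Definition cmoment (a : R) j T := \int[nu]_(p in cdisc T) rweight a j (nsq p).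
Definition moment (a : R) j := \int[nu]_(p in D) rweight a j (nsq p).

Lemma integrable_cdisc_rweight a j T : T < 1 ->
  nu.-integrable (cdisc T) (EFin \o (fun p => rweight a j (nsq p))).
Proof. by move=> T1; apply: (integrable_cdisc T1) => p; exact: continuous_rweight_nsq. Qed.

Lemma fine_cdisc T : T < 1 -> 0 <= fine (nu (cdisc T)) <= 4.
Proof.
move=> T1; rewrite fine_ge0 //=.
have h : (nu (cdisc T) <= 4%:E)%E.
  apply: (le_trans _ (leb2_udisc2 R)); apply: le_measure; rewrite ?inE.
  - exact: measurable_cdisc.
  - exact: measurable_udisc2.
  - exact: cdisc_sub.
rewrite -[leRHS]/(fine 4%:E) fine_le//.
by rewrite ge0_fin_numE// (le_lt_trans h)// ltry.
Qed.

(** Apply [integral_radial_euler] with [rweight (a + 1) j] itself as primitive: [P + t P'] equals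
    [(j + 1) rweight a j - (a + j + 2) rweight a j.+1]. The term [P T] times the area is the defect
    that disappears as [T] tends to 1. *)
Lemma cmoment_recl (a T : R) j : T < 1 ->
  j.+1%:R * cmoment a j T =
  (a + j.+2%:R) * cmoment a j.+1 T + rweight (a + 1) j T * fine (nu (cdisc T)).
Proof.
move=> T1; pose W (t : R) := j%:R * ((1 - t) `^ (a + 1) * t ^+ j.-1) - (a + 1) * rweight a j t.
have := @integral_radial_euler R (rweight (a + 1) j) W _ _ T T1.
move=> /(_ (fun t t1 => is_derive_rweight a j t1)).
have cW (t : R) : t < 1 -> {for t, continuous W}.
  move=> t1.
  have c1 : {for t, continuous (fun t : R => j%:R * rweight (a + 1) j.-1 t)}.
    by apply: continuousM_at; [exact: continuous_cst_at|exact: rweight_continuous].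
  have c2 : {for t, continuous (fun t : R => (a + 1) * rweight a j t)}.
    by apply: continuousM_at; [exact: continuous_cst_at|exact: rweight_continuous].
  exact: (cvgB c1 c2).
move=> /(_ cW) /(congr1 fine) h.
have i0 := integrable_cdisc_rweight a j T1.
have i1 := integrable_cdisc_rweight a j.+1 T1.
have mT := @measurable_cdisc R T.
have i0' : nu.-integrable (cdisc T) (EFin \o (fun p => j.+1%:R * rweight a j (nsq p))).
  by apply: (integrable_cdisc T1) => p pD; apply: continuousM_at; [exact:
      continuous_cst_at|exact: continuous_rweight_nsq].
have i1' : nu.-integrable (cdisc T) (EFin \o (fun p => (a + j.+2%:R) * rweight a j.+1 (nsq p))).
  by apply: (integrable_cdisc T1) => p pD; apply: continuousM_at; [exact:
      continuous_cst_at|exact: continuous_rweight_nsq].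
have ic : nu.-integrable (cdisc T) (EFin \o (fun=> rweight (a + 1) j T)).
  by apply: (integrable_cdisc T1) => p pD; exact: continuous_cst_at.
have i2 : nu.-integrable (cdisc T) (EFin \o (fun p => j.+1%:R * rweight a j (nsq p) - (a +
    j.+2%:R) * rweight a j.+1 (nsq p))).
  apply: (integrable_cdisc T1) => p pD; apply: continuousD_at.
    by apply: continuousM_at; [exact: continuous_cst_at|exact: continuous_rweight_nsq].
  by apply: continuousN_at; apply: continuousM_at; [exact: continuous_cst_at|exact:
      continuous_rweight_nsq].
have : \int[nu]_(p in cdisc T) (j.+1%:R * rweight a j (nsq p) -
    (a + j.+2%:R) * rweight a j.+1 (nsq p) - rweight (a + 1) j T) = 0.
  rewrite -[RHS]h; apply: eq_Rintegral => p /set_mem /(cdisc_sub T1).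
  rewrite udisc2E /= => p1; rewrite /W /rweight !onem_powR1// -!natr1.
  by case: j {W cW i0 i1 i0' i1' ic i2 h} => [|j]; rewrite /= ?exprS; ring.
rewrite RintegralB// RintegralB// (RintegralZl j.+1%:R)// (RintegralZl (a + j.+2%:R))//
    Rintegral_cst//.
by rewrite /cmoment => /eqP; rewrite subr_eq0 subr_eq addrC => /eqP.
Qed.

(* [cmoment a 0 T - cmoment a 1 T] integrates [(1 - t)^(a+1) <= 1] over a set of
   area at most [4]; the recurrence then bounds [cmoment a 0 T] uniformly in [T]. *)
Lemma cmoment0_le (a T : R) : -1 < a -> T < 1 -> cmoment a 0 T <= 4 * (a + 2) / (a + 1).
Proof.
move=> a1 T1; have a0 : 0 < a + 1 by lra.
have /andP[A0 A4] := fine_cdisc T1.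
have := cmoment_recl a 0 T1; rewrite mul1r => e.
have J : cmoment a 0 T - cmoment a 1 T <= 4.
  rewrite /cmoment -RintegralB//; first last.
  - exact: integrable_cdisc_rweight.
  - exact: integrable_cdisc_rweight.
  - exact: measurable_cdisc.
  apply: (@le_trans _ _ (\int[nu]_(p in cdisc T) 1)).
    apply: le_Rintegral.
    - exact: measurable_cdisc.
    - apply: (integrable_cdisc T1) => p pD; apply: continuousD_at; first exact:
        continuous_rweight_nsq.
      by apply: continuousN_at; exact: continuous_rweight_nsq.
    - by apply: (integrable_cdisc T1) => p pD; exact: continuous_cst_at.
    - move=> p /(cdisc_sub T1); rewrite udisc2E /= => p1.
      have p0 := nsq_ge0 p.
      rewrite /rweight expr0 expr1 -mulrBr -onem_powR1//.
      apply: (@le_trans _ _ (1 `^ (a + 1))); last by rewrite powR1.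
      by apply: ge0_ler_powR; rewrite ?nnegrE; lra.
  by rewrite Rintegral_cst ?mul1r//; exact: measurable_cdisc.
have P0 : 0 <= rweight (a + 1) 0 T * fine (nu (cdisc T)).
  by rewrite mulr_ge0// /rweight expr0 mulr1 powR_ge0.
rewrite ler_pdivlMr//.
have a2 : 0 <= a + 2 by lra.
have := ler_wpM2l a2 J; lra.
Qed.

(** For [a < 0] the weight is unbounded, so the case [j = 0] rests on monotone convergence and the
    uniform bound [cmoment0_le]; the other [j] are dominated by it because [|z|^2 < 1]. *)
Lemma integrable_rweight (a : R) j : -1 < a ->
  nu.-integrable D (EFin \o (fun p => rweight a j (nsq p))).
Proof.
move=> a1.
have i0 : nu.-integrable D (EFin \o (fun p => rweight a 0 (nsq p))).
  apply/integrableP; split.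
    by apply/measurable_EFinP; exact: measurable_rweight.
  have -> : (\int[nu]_(p in D) `|(EFin \o (fun p => rweight a 0 (nsq p))) p| =
      \int[nu]_(p in D) (rweight a 0 (nsq p))%:E)%E.
    by apply: eq_integral => p _; rewrite gee0_abs// lee_fin rweight_ge0// nsq_ge0.
  apply: (@le_lt_trans _ _ (4 * (a + 2) / (a + 1))%:E); last exact: ltry.
  have mr n : measurable_fun (cdisc (drad R n) : set RR) (fun p => (rweight a 0 (nsq p))%:E).
    apply/measurable_EFinP; apply: (measurable_funS _ _ (@measurable_rweight R a 0)).
      exact: measurable_udisc2.
    by apply: cdisc_sub; exact: drad_lt1.
  have := @ge0_nondecreasing_set_cvg_integral _ RR R (fun n => cdisc (drad R n))
    (fun p => (rweight a 0 (nsq p))%:E) nu (@cdisc_homo R) (fun n => measurable_cdisc _) mr.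
  have r0 i x : cdisc (drad R i) x -> (0 <= (rweight a 0 (nsq x))%:E)%E.
    by move=> _; rewrite lee_fin rweight_ge0// nsq_ge0.
  move=> /(_ r0); rewrite bigcup_cdisc => cv.
  rewrite -(cvg_lim _ cv)//; apply: lime_le; first by apply: cvgP cv.
  apply: nearW => n.
  have T1 := drad_lt1 R n.
  rewrite -[leLHS]fineK; last first.
    apply: (integrable_fin_num (@measurable_cdisc R (drad R n))).
    exact: (integrable_cdisc_rweight a 0 T1).
  by rewrite lee_fin; exact: cmoment0_le.
apply: le_integrable i0.
- exact: measurable_udisc2.
- by apply/measurable_EFinP; exact: measurable_rweight.
- move=> p; rewrite udisc2E /= => p1; rewrite lee_fin !ger0_norm ?rweight_ge0 ?nsq_ge0//.
  rewrite /rweight expr0 mulr1 ler_piMr ?powR_ge0// exprn_ile1 ?nsq_ge0//.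
  exact: ltW.
Qed.

Lemma moment_recl (a : R) j : -1 < a ->
  j.+1%:R * moment a j = (a + j.+2%:R) * moment a j.+1.
Proof.
move=> a1.
have c0 := integral_disc_lim (integrable_rweight j a1).
have c1 := integral_disc_lim (integrable_rweight j.+1 a1).
(* As [1 - drad n = 1 / (n + 1)], the defect lies between 0 and [4 (n + 1)^-(a + 1)]; the exponent
   [a + 1] is positive. *)
have c2 : (fun n => rweight (a + 1) j (drad R n) * fine (nu (cdisc (drad R n)))) @ \oo --> (0 : R).
  have hp : (fun n => n.+1%:R^-1 `^ (a + 1) : R) @ \oo --> (0 : R).
    have a0 : 0 < a + 1 by lra.
    have := powR_cvg0 a0; move=> /cvg_at_rightP; apply; split => [n|]; first by rewrite invr_gt0.
    exact: cvg_harmonic.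
  have h4 : (fun n => n.+1%:R^-1 `^ (a + 1) * 4 : R) @ \oo --> (0 : R).
    by rewrite -[0](mul0r (4 : R)); exact: cvgM hp (cvg_cst _).
  apply: (squeeze_cvgr _ (cvg_cst (0 : R)) h4); apply: nearW => n.
  have /andP[A0 A4] := fine_cdisc (drad_lt1 R n).
  have r0 := drad_ge0 R n; have r1 := drad_lt1 R n.
  rewrite /= mulr_ge0 ?rweight_ge0//= ler_pM ?rweight_ge0//.
  rewrite /rweight {1}/drad opprB addrCA subrr addr0.
  by rewrite ler_piMr ?powR_ge0// exprn_ile1// ltW.
have e n := cmoment_recl a j (drad_lt1 R n).
have l1 := cvgM (cvg_cst (j.+1%:R : R)) c0.
have l2 := cvgD (cvgM (cvg_cst (a + j.+2%:R)) c1) c2.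
rewrite addr0 in l2.
have l3 : (fun n => j.+1%:R * cmoment a j (drad R n)) @ \oo --> j.+1%:R * moment a j.
  exact: l1.
have l4 : (fun n => j.+1%:R * cmoment a j (drad R n)) @ \oo --> (a + j.+2%:R) * moment a j.+1.
  by under eq_fun do rewrite e; exact: l2.
by rewrite -(cvg_lim (@Rhausdorff R) l3) -(cvg_lim (@Rhausdorff R) l4).
Qed.

Lemma moment0_gt0 (a : R) : -1 < a -> 0 < moment a 0.
Proof.
(* With [b] both signs of [a] are treated together: for [t <= 1/2],
   [(1 - t)^a >= (1 - t)^b >= (1/2)^b]. *)
move=> a1; pose b := Num.max a 0.
have i0 := integrable_rweight 0 a1.
have h1 : (2^-1 : R) < 1 by lra.
have c0 : 0 < 2^-1 `^ b :> R by rewrite powR_gt0.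
(* A square of area 1 inside the disc [|z|^2 <= 1/2] bounds the area of the disc from below. *)
have sq : `[- 2^-1, 2^-1] `*` `[- 2^-1, 2^-1] `<=` cdisc (2^-1 : R).
  move=> [x y] []; rewrite /= !in_itv /= -!ler_norml /cdisc /nsq /= => hx hy.
  have e2 (t : R) : `|t| <= 2^-1 -> t ^+ 2 <= 4^-1.
    move=> ht; rewrite -real_normK ?num_real// (_ : 4^-1 = 2^-1 ^+ 2); last by field.
    by rewrite ler_pXn2r ?nnegrE.
  by have := e2 _ hx; have := e2 _ hy; lra.
have m1 : 1 <= fine (nu (cdisc (2^-1 : R))).
  have /andP[_ A4] := fine_cdisc h1.
  rewrite -[leLHS]/(fine 1%:E) fine_le//.
    rewrite ge0_fin_numE// (@le_lt_trans _ _ (leb2 D)) ?(le_lt_trans (leb2_udisc2 R)) ?ltry//.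
    apply: le_measure; rewrite ?inE; [exact: measurable_cdisc|exact:
        measurable_udisc2|exact: cdisc_sub].
  apply: (@le_trans _ _ (nu (`[- 2^-1, 2^-1]%classic `*` `[- 2^-1, 2^-1]%classic))).
    rewrite product_measure1E//= lebesgue_measure_itv /= lte_fin.
    rewrite ifT; last by lra.
    by rewrite -!EFinD -EFinM lee_fin; lra.
  by apply: le_measure; rewrite ?inE; [exact: measurableX|exact: measurable_cdisc|exact: sq].
apply: (@lt_le_trans _ _ (cmoment a 0 2^-1)); last first.
  rewrite /cmoment /moment /Rintegral; apply: fine_le.
  - by apply: (integrable_fin_num (measurable_cdisc _)); exact: (integrable_cdisc_rweight a 0 h1).
  - exact: (integrable_fin_num (@measurable_udisc2 R) i0).
  apply: ge0_subset_integral.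
  - exact: measurable_cdisc.
  - exact: measurable_udisc2.
  - by apply/measurable_EFinP; exact: measurable_rweight.
  - by move=> p _; rewrite lee_fin rweight_ge0// nsq_ge0.
  - exact: cdisc_sub.
apply: (@lt_le_trans _ _ (\int[nu]_(p in cdisc 2^-1) (2^-1 `^ b))).
  rewrite Rintegral_cst; last exact: measurable_cdisc.
  by rewrite mulr_gt0// (lt_le_trans ltr01).
apply: le_Rintegral.
- exact: measurable_cdisc.
- by apply: (integrable_cdisc h1) => p pD; exact: continuous_cst_at.
- exact: integrable_cdisc_rweight.
- move=> p; rewrite /cdisc /= => ph; have p0 := nsq_ge0 p.
  rewrite /rweight expr0 mulr1; apply: (@le_trans _ _ ((1 - nsq p) `^ b)).
    by rewrite ge0_ler_powR ?nnegrE ?le_max ?lexx ?orbT//; lra.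
  by apply: ger_powR; rewrite ?le_max ?lexx//; apply/andP; split; lra.
Qed.

Lemma moment_prod (a : R) m : -1 < a ->
  moment a m * \prod_(j < m) (a + j.+2%:R) = m`!%:R * moment a 0.
Proof.
move=> a1; elim: m => [|m IH]; first by rewrite big_ord0 mulr1 mul1r.
rewrite big_ord_recr /= mulrCA [moment a m.+1 * _]mulrC -moment_recl// mulrCA.
by rewrite [_ * moment a m]mulrC IH factS natrM mulrA.
Qed.

End Moments.

(** * The Gamma function *)

Section GammaFunction.
Variable R : realType.
Local Notation mu := (@lebesgue_measure R).

(** The exponent is [s], not [s - 1]: this is the integrand of [Gamma (s + 1)]. *)
Definition gamma_integrand (s t : R) := t `^ s * expR (- t).

Lemma gamma_integrand_ge0 s t : 0 <= gamma_integrand s t.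
Proof. by rewrite mulr_ge0 ?powR_ge0 ?expR_ge0. Qed.

Lemma is_derive_gamma_integrand (s t : R) : 0 < t ->
  is_derive t 1 (gamma_integrand s) (s * gamma_integrand (s - 1) t - gamma_integrand s t).
Proof.
move=> t0; have h := is_derive1_powR s t0.
rewrite /gamma_integrand; apply: is_derive_eq; rewrite /GRing.scale /=; ring.
Qed.

Lemma gamma_integrand_continuous (s t : R) : 0 < t -> {for t, continuous (gamma_integrand s)}.
Proof.
move=> t0; have h := is_derive_gamma_integrand s t0.
by apply/differentiable_continuous/derivable1_diffP; apply: ex_derive.
Qed.

Lemma measurable_gamma_integrand (s : R) : measurable_fun (`]0, +oo[%classic : set
    (measurableTypeR R)) (gamma_integrand s).
Proof.
apply: open_continuous_measurable_fun; first exact: interval_open.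
by move=> t /set_mem; rewrite /= in_itv /= andbT; exact: gamma_integrand_continuous.
Qed.

Lemma gamma_integrand_cvgy (s : R) : 0 < s -> (fun n : nat => gamma_integrand s n.+2%:R) @
    \oo --> (0 : R).
Proof.
(* An integer [k >= s]; then [x^(k + 1) <= (k + 1)! e^x] gives [x^s e^(-x) <= (k + 1)! / x] for
   [x >= 1]. *)
move=> s0; pose k := (Num.trunc s).+1.
have sk : s <= k%:R by rewrite ltW// truncnS_gt.
have h : (fun n : nat => k.+1`!%:R * n.+1%:R^-1 : R) @ \oo --> (0 : R).
  have := cvgM (cvg_cst (k.+1`!%:R : R)) (@cvg_harmonic R).
  by rewrite mulr0; apply.
apply: (squeeze_cvgr _ (cvg_cst (0 : R)) h); apply: nearW => n.
rewrite gamma_integrand_ge0 /=; pose x : R := n.+2%:R.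
have x1 : 1 <= x by rewrite ler1n.
have x0 : 0 < x by rewrite ltr0n.
have e1 : x `^ s <= x ^+ k by rewrite -powR_mulrn ?ler_powR// ltW.
have := expR_ge1Dxn k (ltW x0).
have f0 : 0 < k.+1`!%:R :> R by rewrite ltr0n fact_gt0.
move=> e2; have {}e2 : x ^+ k.+1 <= k.+1`!%:R * expR x.
  by rewrite mulrC -ler_pdivrMr//; lra.
rewrite -/x /gamma_integrand expRN ler_pdivrMr ?expR_gt0// mulrAC ler_pdivlMr ?ltr0n//.
apply: le_trans e2; rewrite exprSr ler_pM ?powR_ge0//.
by rewrite ler_nat.
Qed.

Lemma gamma_integrand_cvg0 (s : R) : 0 < s -> (fun n : nat => gamma_integrand s n.+2%:R^-1)
    @ \oo --> (0 : R).
Proof.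
move=> s0.
have h : (fun n : nat => n.+1%:R^-1 `^ s : R) @ \oo --> (0 : R).
  have := powR_cvg0 s0; move=> /cvg_at_rightP; apply; split => [n|]; first by rewrite invr_gt0.
  exact: cvg_harmonic.
apply: (squeeze_cvgr _ (cvg_cst (0 : R)) h); apply: nearW => n.
rewrite gamma_integrand_ge0 /= /gamma_integrand.
apply: (@le_trans _ _ (n.+2%:R^-1 `^ s)).
  by rewrite ler_piMr ?powR_ge0// expR_le1 oppr_le0.
by apply: ge0_ler_powR; rewrite ?nnegrE ?invr_ge0 ?(ltW s0)// lef_pV2 ?posrE// ler_nat.
Qed.

(** The shift by 2 keeps the interval nondegenerate at [n = 0] too, as the fundamental theorem of
    calculus requires. *)
Let J (n : nat) : set R := `[n.+2%:R^-1, n.+2%:R]%classic.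

Let J_homo : {homo J : n m / (n <= m)%N >-> (n <= m)%O}.
Proof.
move=> n m nm; rewrite subsetEset => x; rewrite /J /= !in_itv /= => /andP[x1 x2].
apply/andP; split; [apply: le_trans x1|apply: (le_trans x2)].
  by rewrite lef_pV2 ?posrE// ler_nat.
by rewrite ler_nat.
Qed.

Let bigcup_J : \bigcup_n J n = `]0, +oo[%classic.
Proof.
apply/seteqP; split => [x [n _]|x]; rewrite /J /= !in_itv /= andbT.
  by move=> /andP[x1 _]; rewrite (lt_le_trans _ x1).
move=> x0; have [N _ hN] := near_infty_natSinv_lt (PosNum x0).
pose M := maxn N (Num.trunc x).+1.
exists M => //; rewrite /J /= in_itv /=; apply/andP; split.
  have /= h := hN N (leqnn N); apply: le_trans (ltW h).
  by rewrite lef_pV2 ?posrE// ler_nat ltnS (leq_trans (leq_maxl _ _) (leqnSn M)).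
apply: (@le_trans _ _ (Num.trunc x).+1%:R); first by rewrite ltW// truncnS_gt.
by rewrite ler_nat (leq_trans (leq_maxr N _))// -/M (leq_trans (leqnSn _) (leqnSn _)).
Qed.

Let J_pos n : J n `<=` `]0, +oo[%classic.
Proof. by rewrite -bigcup_J => x Jx; exists n. Qed.

Let within_gint s n : {within J n, continuous (gamma_integrand s)}.
Proof.
apply: continuous_in_subspaceT => x /set_mem /J_pos.
by rewrite /= in_itv /= andbT; exact: gamma_integrand_continuous.
Qed.

Let integrable_gint s n : mu.-integrable (J n) (EFin \o gamma_integrand s).
Proof.
by apply: continuous_compact_integrable; [exact: segment_compact|exact: within_gint].
Qed.

Let cvg_gint s : (\int[mu]_(x in J n) (gamma_integrand s x)%:E)%E @[n --> \oo] -->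
  (\int[mu]_(x in `]0%R, +oo[) (gamma_integrand s x)%:E)%E.
Proof.
rewrite -bigcup_J; apply: ge0_nondecreasing_set_cvg_integral => //.
- by move=> n; exact: measurable_itv.
- move=> n; apply/measurable_EFinP; apply: (measurable_funS _ _ (measurable_gamma_integrand s)).
    exact: measurable_itv.
  exact: J_pos.
- by move=> n x _; rewrite lee_fin gamma_integrand_ge0.
Qed.

(** Integration by parts, obtained by integrating the derivative of [t^s e^(-t)] over [J n]. *)
Let J_parts (s : R) n : (s%:E * \int[mu]_(x in J n) (gamma_integrand (s - 1) x)%:E =
  \int[mu]_(x in J n) (gamma_integrand s x)%:E + (gamma_integrand s n.+2%:R -
      gamma_integrand s n.+2%:R^-1)%:E)%E.
Proof.
have lt : n.+2%:R^-1 < n.+2%:R :> R.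
  by rewrite (@lt_trans _ _ 1)// ?invf_lt1 ?ltr1n.
have pos (x : R) : n.+2%:R^-1 <= x -> 0 < x by apply: lt_le_trans.
have := @continuous_FTC2 R (fun t => s * gamma_integrand (s - 1) t - gamma_integrand s t)
    (gamma_integrand s) _ _ lt.
have h1 : {within `[n.+2%:R^-1, n.+2%:R], continuous (fun t => s * gamma_integrand (s - 1)
    t - gamma_integrand s t)}.
  apply: continuous_in_subspaceT => x /set_mem /J_pos; rewrite /= in_itv /= andbT => x0.
  have c1 := @gamma_integrand_continuous s x x0; have c2 := @gamma_integrand_continuous (s
      - 1) x x0.
  exact: (cvgB (cvgM (cvg_cst s) c2) c1).
have h2 : derivable_oo_LRcontinuous (gamma_integrand s) n.+2%:R^-1 n.+2%:R.
  split.
  - move=> x; rewrite in_itv /= => /andP[/ltW/pos x1 x2].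
    by have h := is_derive_gamma_integrand s x1; apply: ex_derive.
  - by apply: cvg_at_right_filter; apply: gamma_integrand_continuous; rewrite invr_gt0.
  - by apply: cvg_at_left_filter; apply: gamma_integrand_continuous.
have h3 : {in `]n.+2%:R^-1, n.+2%:R[, (gamma_integrand s)^`()%classic =1 (fun t => s *
    gamma_integrand (s - 1) t - gamma_integrand s t)}.
  move=> x; rewrite in_itv /= => /andP[/ltW/pos x1 x2].
  by have h := is_derive_gamma_integrand s x1; rewrite derive1E; apply: derive_val.
move=> /(_ h1 h2 h3).
have i1 := integrable_gint s n; have i2 := integrable_gint (s - 1) n.
have mJ : measurable (J n : set (measurableTypeR R)) by exact: measurable_itv.
have i3 : mu.-integrable (J n) (EFin \o (fun x => s * gamma_integrand (s - 1) x)).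
  apply: continuous_compact_integrable; first exact: segment_compact.
  apply: continuous_in_subspaceT => x /set_mem /J_pos; rewrite /= in_itv /= andbT => x0.
  exact: (cvgM (cvg_cst s) (@gamma_integrand_continuous (s - 1) x x0)).
have fi := integrable_fin_num mJ i1.
rewrite -/(J n) (integralB_EFin mJ i3 i1).
under eq_integral do rewrite EFinM.
rewrite (integralZl mJ i2).
move=> /(congr1 (fun z => (\int[mu]_(x in J n) (gamma_integrand s x)%:E + z)%E)).
by rewrite addeC subeK// => ->; rewrite EFinB.
Qed.

(** The limit is taken in the extended reals, where monotone convergence holds with value [+oo]
    allowed; the real identity is extracted at the end. *)
Lemma GammaD1 (s : R) : 0 < s -> Gamma (s + 1) = s * Gamma s.
Proof.
move=> s0; rewrite /Gamma addrK /Rintegral.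
pose A := (\int[mu]_(x in `]0%R, +oo[) (gamma_integrand s x)%:E)%E.
pose B := (\int[mu]_(x in `]0%R, +oo[) (gamma_integrand (s - 1) x)%:E)%E.
change (fine A = s * fine B).
have cA : _ --> A := @cvg_gint s; have cB : _ --> B := @cvg_gint (s - 1).
have B0 : (0 <= B)%E by apply: integral_ge0 => x _; rewrite lee_fin gamma_integrand_ge0.
have c1 : (s%:E * \int[mu]_(x in J n) (gamma_integrand (s - 1) x)%:E)%E @[n --> \oo] -->
    (s%:E * B)%E.
  by apply: cvgeZl.
have c2 : (s%:E * \int[mu]_(x in J n) (gamma_integrand (s - 1) x)%:E)%E @[n --> \oo] --> A.
  under eq_fun do rewrite J_parts.
  rewrite -[A]adde0; apply: cvgeD => //; first by rewrite fin_num_adde_defl.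
  apply: cvg_EFin; first exact: nearW.
  have := cvgB (gamma_integrand_cvgy s0) (gamma_integrand_cvg0 s0); rewrite subr0; exact.
have -> : A = (s%:E * B)%E by apply: (cvg_unique _ c2 c1); exact: ereal_hausdorff.
(* Were the integral [+oo], so would be its multiple by [s > 0], and [fine] sends both to 0. *)
case: B B0 {cB c1} => [b|_|]//; rewrite /= mulr0.
by rewrite gt0_muley// lte_fin.
Qed.

Lemma Gamma_ge0 (s : R) : 0 <= Gamma s.
Proof. by apply: Rintegral_ge0 => x _; exact: gamma_integrand_ge0. Qed.

Lemma Gamma_prod (s : R) m : 0 < s ->
  Gamma (m%:R + s) = \prod_(j < m) (s + j%:R) * Gamma s.
Proof.
move=> s0; elim: m => [|m IH]; first by rewrite add0r big_ord0 mul1r.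
rewrite -natr1 -addrA (addrC 1) addrA GammaD1; last by rewrite ltr_wpDl.
by rewrite IH big_ord_recr /= mulrA [m%:R + s]addrC [_ * (s + _)]mulrC.
Qed.

End GammaFunction.

(** * Integration against dA_alpha *)

Section WeightedIntegral.
Variables (R : realType) (alpha : R).
Hypothesis alpha1 : -1 < alpha.
Local Notation mu := (@lebesgue_measure R).
Local Notation nu := (mu \x mu)%E.
Local Notation D := (@udisc2 R).
Local Notation RR := (measurableTypeR R * measurableTypeR R)%type.
Local Notation w := (@wdens R alpha).
Implicit Types (p : R * R) (F G h : R[i] -> R[i]).

Definition wcst := (alpha + 1) / pi.

Lemma wcst_gt0 : 0 < wcst.
Proof. by rewrite divr_gt0 ?pi_gt0//; have := alpha1; lra. Qed.

Lemma wdensE p : w p = wcst * rweight alpha 0 (nsq p).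
Proof. by rewrite /wdens cmod_toC /rweight expr0 mulr1. Qed.

Lemma wdensX p j : w p * nsq p ^+ j = wcst * rweight alpha j (nsq p).
Proof. by rewrite wdensE /rweight expr0 mulr1 mulrA. Qed.

Lemma wdens_ge0 p : 0 <= w p.
Proof. by rewrite wdensE mulr_ge0 ?(ltW wcst_gt0)// rweight_ge0// nsq_ge0. Qed.

Lemma continuous_wdens p : D p -> {for p, continuous w}.
Proof.
move=> pD; rewrite (_ : w = fun p => wcst * rweight alpha 0 (nsq p)); last first.
  by apply/funext => q; exact: wdensE.
by apply: continuousM_at; [exact: continuous_cst_at|exact: continuous_rweight_nsq].
Qed.

Definition ccont F := forall p, D p ->
  {for p, continuous (fun q => complex.Re (F (toC q)))} /\
  {for p, continuous (fun q => complex.Im (F (toC q)))}.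

Lemma holo_ccont F : holo F -> ccont F.
Proof.
move=> [d hd] p pD; have [lF _] := holat_lip (hd _ pD).
by split; [exact: lipat_Re|exact: lipat_Im].
Qed.

Lemma ccontM F G : ccont F -> ccont G -> ccont (fun z => F z * G z).
Proof.
move=> cF cG p pD; have [F1 F2] := cF _ pD; have [G1 G2] := cG _ pD; split.
  rewrite (_ : (fun _ => _) = fun q => complex.Re (F (toC q)) * complex.Re (G (toC q)) +
     - (complex.Im (F (toC q)) * complex.Im (G (toC q)))).
    by apply: continuousD_at; [exact: continuousM_at|apply: continuousN_at; exact: continuousM_at].
  by apply/funext => q; case: (F _) => ? ?; case: (G _).
rewrite (_ : (fun _ => _) = fun q => complex.Re (F (toC q)) * complex.Im (G (toC q)) +
     complex.Im (F (toC q)) * complex.Re (G (toC q))).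
  by apply: continuousD_at; exact: continuousM_at.
by apply/funext => q; case: (F _) => ? ?; case: (G _).
Qed.

Lemma ccontJ F : ccont F -> ccont (fun z => (F z)^*%C).
Proof.
move=> cF p pD; have [F1 F2] := cF _ pD; split.
  rewrite (_ : (fun _ => _) = fun q => complex.Re (F (toC q)))//.
  by apply/funext => q; case: (F _).
rewrite (_ : (fun _ => _) = fun q => - complex.Im (F (toC q))).
  exact: continuousN_at.
by apply/funext => q; case: (F _).
Qed.

Definition wRe F p := w p * complex.Re (F (toC p)).
Definition wIm F p := w p * complex.Im (F (toC p)).

(** The condition under which [wI] is linear; it accompanies every computed value of [wI]. *)
Definition wint F := nu.-integrable D (EFin \o wRe F) /\ nu.-integrable D (EFin \o wIm F).

Definition wI F : R[i] :=
  Complex (Rintegral nu D (wRe F)) (Rintegral nu D (wIm F)).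

Lemma binnerE (f g : R[i] -> R[i]) : binner alpha f g = wI (fun z => f z * (g z)^*%C).
Proof. by []. Qed.

Lemma wint_dom F (g : R * R -> R) : ccont F -> nu.-integrable D (EFin \o g) ->
  (forall p, D p -> w p * cmod (F (toC p)) <= g p) -> wint F.
Proof.
move=> cF ig le; split; apply: le_integrable ig.
- exact: measurable_udisc2.
- apply/measurable_EFinP; apply: (continuous_measurable2 (@open_udisc2 R)) => p pD.
  by apply: continuousM_at; [exact: continuous_wdens|have [] := cF _ pD].
- move=> p pD; rewrite /= lee_fin normrM ger0_norm ?wdens_ge0//.
  apply: (le_trans _ (ler_norm _)); apply: (le_trans _ (le _ pD)).
  by rewrite ler_wpM2l ?wdens_ge0// Re_le_cmod.
- exact: measurable_udisc2.
- apply/measurable_EFinP; apply: (continuous_measurable2 (@open_udisc2 R)) => p pD.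
  by apply: continuousM_at; [exact: continuous_wdens|have [] := cF _ pD].
- move=> p pD; rewrite /= lee_fin normrM ger0_norm ?wdens_ge0//.
  apply: (le_trans _ (ler_norm _)); apply: (le_trans _ (le _ pD)).
  by rewrite ler_wpM2l ?wdens_ge0// Im_le_cmod.
Qed.

Lemma integrable_wdensX j : nu.-integrable D (EFin \o (fun p => w p * nsq p ^+ j)).
Proof.
rewrite (_ : _ \o _ = fun p => (wcst%:E * (EFin \o (fun p => rweight alpha j (nsq p))) p)%E).
  by apply: integrableZl; [exact: measurable_udisc2|exact: integrable_rweight].
by apply/funext => p; rewrite /= wdensX.
Qed.

Lemma Rintegral_wdensX j :
  Rintegral nu D (fun p => w p * nsq p ^+ j) = wcst * moment alpha j.
Proof.
under eq_Rintegral do rewrite wdensX.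
by rewrite RintegralZl//; [exact: measurable_udisc2|exact: integrable_rweight].
Qed.

Lemma integrable_wdens : nu.-integrable D (EFin \o w).
Proof.
rewrite (_ : EFin \o w = EFin \o (fun p => w p * nsq p ^+ 0)); first exact: integrable_wdensX.
by apply/funext => p; rewrite /= expr0 mulr1.
Qed.

Lemma wint_bounded F : ccont F -> (forall z, udisc z -> cmod (F z) <= 1) -> wint F.
Proof.
move=> cF F1; apply: (wint_dom cF integrable_wdens) => p pD.
by rewrite ler_piMr ?wdens_ge0// F1.
Qed.

Lemma measurable_wsq F : ccont F -> measurable_fun (D : set RR) (fun p => w p * cmod (F
    (toC p)) ^+ 2).
Proof.
move=> cF; apply: (continuous_measurable2 (@open_udisc2 R)) => p pD.
have [F1 F2] := cF _ pD.
apply: continuousM_at; first exact: continuous_wdens.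
rewrite (_ : (fun _ => _) = fun q => complex.Re (F (toC q)) * complex.Re (F (toC q)) +
     complex.Im (F (toC q)) * complex.Im (F (toC q))).
  by apply: continuousD_at; exact: continuousM_at.
by apply/funext => q; rewrite sqr_cmod -!expr2.
Qed.

Lemma integrable_wsq F : ccont F -> (bnorm2 alpha F < +oo)%E ->
  nu.-integrable D (EFin \o (fun p => w p * cmod (F (toC p)) ^+ 2)).
Proof.
move=> cF nF; apply/integrableP; split.
  by apply/measurable_EFinP; exact: measurable_wsq.
apply: le_lt_trans nF; rewrite /bnorm2 /leb2 le_eqVlt; apply/orP; left; apply/eqP.
apply: eq_integral => p _; rewrite gee0_abs// lee_fin mulr_ge0 ?wdens_ge0//.
by rewrite exprn_ge0// cmod_ge0.
Qed.

(** The second factors will be [1] and [z^m], bounded by 1 on the disc, so the inequality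
    [|F| <= |F|^2 + 1] and the finite total mass do the work of Cauchy-Schwarz. *)
Lemma wint_l2 F G : ccont F -> (bnorm2 alpha F < +oo)%E -> ccont G ->
  (forall z, udisc z -> cmod (G z) <= 1) -> wint (fun z => F z * (G z)^*%C).
Proof.
move=> cF nF cG G1.
have iF := integrable_wsq cF nF.
have ig : nu.-integrable D (EFin \o (fun p => w p * cmod (F (toC p)) ^+ 2 + w p)).
  exact: (integrableD (@measurable_udisc2 R) iF integrable_wdens).
apply: (wint_dom _ ig); first by apply: ccontM => //; exact: ccontJ.
move=> p pD; rewrite -[X in _ + X]mulr1 -mulrDr ler_wpM2l ?wdens_ge0//.
have -> : cmod ((F (toC p)) * (G (toC p))^*%C) = cmod (F (toC p)) * cmod (G (toC p)).
  by rewrite cmodM; congr (_ * _); case: (G _) => x y; rewrite !cmodE /= sqrrN.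
have := G1 _ pD; have := cmod_ge0 (F (toC p)); have := cmod_ge0 (G (toC p)).
by have := sqr_ge0 (cmod (F (toC p)) - 1); rewrite !expr2; nra.
Qed.

Lemma wintD F G : wint F -> wint G ->
  wint (fun z => F z + G z) /\ wI (fun z => F z + G z) = wI F + wI G.
Proof.
move=> [F1 F2] [G1 G2].
have eR : wRe (fun z => F z + G z) = fun p => wRe F p + wRe G p.
  by apply/funext => p; rewrite /wRe -mulrDr; case: (F _) => ? ?; case: (G _).
have eI : wIm (fun z => F z + G z) = fun p => wIm F p + wIm G p.
  by apply/funext => p; rewrite /wIm -mulrDr; case: (F _) => ? ?; case: (G _).
split; last first.
  by rewrite /wI eR eI !RintegralD//; exact: measurable_udisc2.
rewrite /wint eR eI; split.
  exact: (integrableD (@measurable_udisc2 R) F1 G1).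
exact: (integrableD (@measurable_udisc2 R) F2 G2).
Qed.

Lemma wintZ c F : wint F -> wint (fun z => c * F z) /\ wI (fun z => c * F z) = c * wI F.
Proof.
move=> [F1 F2]; case: c => a b.
have mD := @measurable_udisc2 R.
have eR : wRe (fun z => Complex a b * F z) = fun p => a * wRe F p - b * wIm F p.
  by apply/funext => p; rewrite /wRe /wIm; case: (F _) => x y /=; ring.
have eI : wIm (fun z => Complex a b * F z) = fun p => a * wIm F p + b * wRe F p.
  by apply/funext => p; rewrite /wRe /wIm; case: (F _) => x y /=; ring.
have Z (k : R) (g : R * R -> R) : nu.-integrable D (EFin \o g) ->
    nu.-integrable D (EFin \o (fun p => k * g p)).
  by move=> ig; exact: (integrableZl mD k ig).
split; last first.
  rewrite /wI eR eI RintegralB ?RintegralD ?RintegralZl//; try exact: Z.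
rewrite /wint eR eI; split.
  exact: (integrableB mD (Z a _ F1) (Z b _ F2)).
exact: (integrableD mD (Z a _ F2) (Z b _ F1)).
Qed.

Lemma wI_ext F G : (forall z, udisc z -> F z = G z) -> wI F = wI G.
Proof.
move=> FG; congr Complex; apply: eq_Rintegral => p /set_mem pD.
  by rewrite /wRe FG.
by rewrite /wIm FG.
Qed.

Lemma toC_mulJ p : toC p * (toC p)^*%C = (nsq p)%:C%C.
Proof.
by case: p => x y; apply/eqP; rewrite eq_complex /nsq /=; apply/andP; split; apply/eqP; ring.
Qed.

(** The factor [|z|^(2 j)] merges with the density into the radial weight [rweight alpha j]; the
    integral over each smaller disc vanishes, and integrability over the whole disc carries this to
    the limit. *)
Lemma wI_orth_Re h j : holo h -> wint (fun z => (z * z^*%C) ^+ j * (z * h z)) ->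
  Rintegral nu D (wRe (fun z => (z * z^*%C) ^+ j * (z * h z))) = 0.
Proof.
move=> hh [ih _]; set F := fun z => _ in ih *.
have [P hP] := rweight_primitive j alpha1.
have e p : wRe F p = wcst * (rweight alpha j (nsq p) * complex.Re (toC p * h (toC p))).
  rewrite /wRe /F [RHS]mulrA -wdensX toC_mulJ -rmorphXn -[RHS]mulrA /=; congr (_ * _).
  by case: (h _) => a b /=; ring.
have := integral_disc_lim ih.
have -> : (fun n => \int[nu]_(p in cdisc (drad R n)) wRe F p) = fun=> 0.
  apply/funext => n; have T1 := drad_lt1 R n.
  have := integral_radial_holo hP (fun t t1 => @rweight_continuous R alpha j t t1) T1 hh.
  under eq_Rintegral do rewrite e.
  have ir : nu.-integrable (cdisc (drad R n))
      (EFin \o (fun p => rweight alpha j (nsq p) * complex.Re (toC p * h (toC p)))).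
    apply: (integrable_cdisc T1) => p pD; apply: continuousM_at; first exact:
        continuous_rweight_nsq.
    by have [] := holo_ccont (holoM (@holo_id R) hh) pD.
  rewrite RintegralZl//; last exact: measurable_cdisc.
  by rewrite /Rintegral => ->; rewrite mulr0.
move=> /(cvg_lim (@Rhausdorff R)) <-.
by rewrite lim_cst.
Qed.

Lemma wI_orth h j : holo h -> wint (fun z => (z * z^*%C) ^+ j * (z * h z)) ->
  wI (fun z => (z * z^*%C) ^+ j * (z * h z)) = 0.
Proof.
move=> hh ih; rewrite /wI wI_orth_Re//.
(* [Im u = Re (- i u)] *)
have hg : holo (fun z => Complex 0 (-1) * h z) by apply: holoM => //; exact: holo_cst.
have e : (fun z => (z * z^*%C) ^+ j * (z * (Complex 0 (-1) * h z))) =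
    fun z => Complex 0 (-1) * ((z * z^*%C) ^+ j * (z * h z)).
  by apply/funext => z; ring.
have := @wI_orth_Re _ j hg; rewrite e => /(_ (wintZ _ ih).1) E.
congr Complex; rewrite -[RHS]E; apply: eq_Rintegral => p _.
rewrite /wIm /wRe; congr (_ * _).
by case: (_ * _) => x y /=; ring.
Qed.

Lemma wint_moment j : wint (fun z => (z * z^*%C) ^+ j) /\
  wI (fun z => (z * z^*%C) ^+ j) = (wcst * moment alpha j)%:C%C.
Proof.
have eR : wRe (fun z => (z * z^*%C) ^+ j) = fun p => w p * nsq p ^+ j.
  by apply/funext => p; rewrite /wRe toC_mulJ -rmorphXn.
have eI : wIm (fun z => (z * z^*%C) ^+ j) = fun=> 0.
  by apply/funext => p; rewrite /wIm toC_mulJ -rmorphXn /= mulr0.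
split.
  rewrite /wint eR eI; split; first exact: integrable_wdensX.
  exact: integrable0.
rewrite /wI eR eI Rintegral_wdensX; congr Complex.
by rewrite Rintegral_cst ?mul0r//; exact: measurable_udisc2.
Qed.

End WeightedIntegral.

(** * The numerical range *)

Section NumericalRange.
Variables (R : realType) (alpha : R).
Hypothesis alpha1 : -1 < alpha.
Local Notation mu := (@lebesgue_measure R).
Local Notation nu := (mu \x mu)%E.
Local Notation D := (@udisc2 R).
Local Notation wI := (wI alpha).
Local Notation wint := (wint alpha).
Implicit Types (p : R * R) (F G h : R[i] -> R[i]) (a b : R[i]).

(* The squared norm of [z^j]. *)
Definition znorm2 j := wcst alpha * moment alpha j.

Lemma wI_orth0 h : holo h -> wint (fun z => z * h z) -> wI (fun z => z * h z) = 0.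
Proof.
move=> hh; have e : (fun z => z * h z) = fun z => (z * z^*%C) ^+ 0 * (z * h z).
  by apply/funext => z; rewrite expr0 mul1r.
by rewrite e; exact: wI_orth.
Qed.

Lemma exprE_pred (z : R[i]) m : (0 < m)%N -> z ^+ m = z * z ^+ m.-1.
Proof. by case: m => // m _; rewrite exprS. Qed.

Lemma udisc_exp_le1 (z : R[i]) m : udisc z -> cmod (z ^+ m) <= 1.
Proof. by rewrite /udisc /= => z1; rewrite cmodX exprn_ile1 ?cmod_ge0// ltW. Qed.

Lemma bnorm2_binomial a b m : (0 < m)%N ->
  bnorm2 alpha (fun z => a + b * z ^+ m) =
  (cmod a ^+ 2 * znorm2 0 + cmod b ^+ 2 * znorm2 m)%:E.
Proof.
move=> m0; pose c := 2 * (a^*%C * b).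
have hz : holo (fun z : R[i] => z ^+ m.-1) by apply: holoX; exact: holo_id.
have i1 : wint (fun z => z * z ^+ m.-1).
  apply: (wint_bounded alpha1).
    by apply: ccontM; apply: holo_ccont => //; exact: holo_id.
  by move=> z zD; rewrite -exprE_pred// udisc_exp_le1.
have o1 := wI_orth0 hz i1.
have [i2 e2] := wintZ c i1; rewrite o1 mulr0 in e2.
have [i3 e3] := wint_moment alpha1 m.
have [i4 e4] := wintZ (cmod b ^+ 2)%:C%C i3.
have [i5 e5] := wint_moment alpha1 0.
have [i6 e6] := wintZ (cmod a ^+ 2)%:C%C i5.
have [i7 e7] := wintD i4 i2; have [[i8 _] e8] := wintD i6 i7.
(* [E] agrees with [|a + b z^m|^2] only in its real part: the two conjugate cross terms are replaced
   by [2 conj(a) b z^m], a holomorphic function whose integral is already known to vanish. *)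
set E := fun z => _ in i8 e8.
have eE p : wRe alpha E p = wdens alpha p * cmod (a + b * toC p ^+ m) ^+ 2.
  rewrite /wRe /E; congr (_ * _).
  rewrite toC_mulJ expr0 mulr1 -rmorphXn -exprE_pred// /c.
  have -> : nsq p ^+ m = cmod (toC p ^+ m) ^+ 2 by rewrite cmodX exprAC cmod_toC.
  rewrite !sqr_cmod; clear; case: (toC p ^+ m) => x y; case: a => u v; case: b => s t /=; ring.
have iE : nu.-integrable D (EFin \o (fun p => wdens alpha p * cmod (a + b * toC p ^+ m) ^+ 2)).
  by rewrite (_ : (fun p => _) = wRe alpha E)//; apply/funext => p; rewrite eE.
rewrite /bnorm2 /leb2 -[LHS]fineK; last exact: (integrable_fin_num (@measurable_udisc2 R) iE).
congr EFin.
transitivity (complex.Re (wI E)).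
  by apply: eq_Rintegral => p _; exact: (esym (eE p)).
rewrite e8 e7 e6 e5 e4 e3 e2 /znorm2 /=; ring.
Qed.

Lemma bergman_binomial a b m : (0 < m)%N -> bergman alpha (fun z => a + b * z ^+ m).
Proof.
by move=> m0; split; [exact: analytic_cst_addX|rewrite bnorm2_binomial// ltry].
Qed.

(** The inner product expands into four integrals of [psi] or [psi phi^m] against the conjugate of
    [1] or [z^m]. Boundedness of the operator puts [psi] and [psi phi^m] in L^2, so each integral
    converges and the expansion is legitimate. *)
Lemma binner_wcomp_binomial (phi psi : R[i] -> R[i]) m (c : nat -> R[i]) a b :
  analytic_on (@udisc R) phi -> phi 0 = 0 ->
  analytic_on (@udisc R) psi -> series_near0 c psi -> (0 < m)%N ->
  (forall k, (k < m)%N -> c k = 0) ->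
  wcomp_bounded alpha psi phi ->
  binner alpha (wcomp psi phi (fun z => a + b * z ^+ m)) (fun z => a + b * z ^+ m) =
  a * b^*%C * c m * (znorm2 m)%:C%C.
Proof.
move=> aphi phi0 apsi spsi m0 c0 [M bdd].
have hphi := analytic_holo aphi; have hpsi := analytic_holo apsi.
have [s hs es] : exists2 s, holo s & forall z, phi z = z * s z.
  have D0 : @udisc R 0 by rewrite /udisc /mkset cmod0 ltr01.
  have [r [r0 [_ [e he]]]] := aphi 0 D0.
  have se : series_near0 e phi by exists r; split => // z zr; apply: he; rewrite subr0.
  have e0 : e 0%N = 0 by rewrite -(series_near0_val se).
  by have [s [hs _ es]] := holo_divz hphi se e0; exists s.
have [q [hq sq eq]] := holo_divzX hpsi spsi c0.
have q0 : q 0 = c m by rewrite (series_near0_val sq) addn0.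
(* Now [psi = z^m (c m + z t)]: the leading coefficient is isolated, and the rest keeps a spare
   factor [z]. *)
have [t ht et] : exists2 t, holo t & forall z, q z = c m + z * t z.
  have sq' : exists d, series_near0 d q /\ d 0%N = c m.
    by exists (fun k => c (m + k)%N); rewrite addn0.
  have hg : holo (fun z => q z - c m) by apply: holoD => //; exact: holo_cst.
  have sg : series_near0 (fun k => if k == 0%N then 0 else c (m + k)%N) (fun z => q z - c m).
    have [r [r0 hr]] := sq; exists r; split => // z /hr /ctoP H; apply/ctoP => e /H[N hN].
    (* The partial sum must be nonempty for its constant term to be removed, hence [N.+1]. *)
    exists N.+1 => n Nn; have := hN n (ltnW Nn); congr (_ < _); congr cmod.
    case: n Nn => // n _; rewrite !big_ord_recl /= !expr0 !mulr1 addn0.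
    by rewrite add0r opprB [RHS]addrCA [RHS]addrA.
  by have [t [ht _ et]] := holo_divz hg sg erefl; exists t => // z; rewrite -et addrCA subrr addr0.
have hz j : holo (fun z : R[i] => z ^+ j) by apply: holoX; exact: holo_id.
have hphim : holo (fun z => phi z ^+ m) by exact: holoX.
have cpsi := holo_ccont hpsi.
have cpp : ccont (fun z => psi z * phi z ^+ m) by apply: holo_ccont; exact: holoM.
(* [psi] is the image of the constant function 1, written as a binomial with [b = 0]. *)
have npsi : (bnorm2 alpha psi < +oo)%E.
  have [[_ h] _] := bdd _ (@bergman_binomial 1 0 m m0).
  rewrite (_ : psi = wcomp psi phi (fun z => 1 + 0 * z ^+ m))//.
  by apply/funext => z; rewrite /wcomp mul0r addr0 mulr1.
have npp : (bnorm2 alpha (fun z => psi z * phi z ^+ m)%R < +oo)%E.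
  have [[_ h] _] := bdd _ (@bergman_binomial 0 1 m m0).
  rewrite (_ : (fun z => _) = wcomp psi phi (fun z => 0 + 1 * z ^+ m))//.
  by apply/funext => z; rewrite /wcomp mul1r add0r.
have c1 : ccont (fun=> 1 : R[i]) by apply: holo_ccont; exact: holo_cst.
have b1 (z : R[i]) : udisc z -> cmod (1 : R[i]) <= 1 by rewrite cmod1.
have cz : ccont (fun z : R[i] => z ^+ m) by apply: holo_ccont.
have bz (z : R[i]) : udisc z -> cmod (z ^+ m) <= 1 by exact: udisc_exp_le1.
have J1 : (1 : R[i])^*%C = 1 by rewrite conjc1.
have i1 := wint_l2 alpha1 cpsi npsi c1 b1.
have o1 : wI (fun z => psi z * 1^*%C) = 0.
  have e : (fun z => psi z * 1^*%C) = fun z => z * (z ^+ m.-1 * q z).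
    by apply/funext => z; rewrite J1 mulr1 eq [in LHS]exprE_pred// mulrA.
  by move: i1; rewrite e; apply: wI_orth0; exact: holoM.
have i2 := wint_l2 alpha1 cpp npp c1 b1.
have o2 : wI (fun z => psi z * phi z ^+ m * 1^*%C) = 0.
  have e : (fun z => psi z * phi z ^+ m * 1^*%C) = fun z => z * (z ^+ m.-1 * q z * phi z ^+ m).
    by apply/funext => z; rewrite J1 mulr1 eq [in LHS]exprE_pred// !mulrA.
  by move: i2; rewrite e; apply: wI_orth0; apply: holoM => //; exact: holoM.
have i3 := wint_l2 alpha1 cpp npp cz bz.
have o3 : wI (fun z => psi z * phi z ^+ m * (z ^+ m)^*%C) = 0.
  (* Of the factors [z^m] in [psi] and [z^m] in [phi^m], one is paired with [conj(z)^m], and the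
     other supplies the extra [z] because [m > 0]. *)
  have e : (fun z => psi z * phi z ^+ m * (z ^+ m)^*%C) =
      fun z => (z * z^*%C) ^+ m * (z * (q z * (z ^+ m.-1 * s z ^+ m))).
    apply/funext => z; rewrite eq es !exprMn rmorphXn /=.
    have := exprE_pred z m0; set u := z ^+ m; set v := z ^+ m.-1 => ->.
    set x := _ ^+ m; set y := _ ^+ m. by ring.
  move: i3; rewrite e; apply: wI_orth => //.
  by apply: holoM => //; apply: holoM => //; exact: holoX.
have i4 := wint_l2 alpha1 cpsi npsi cz bz.
have o4 : wI (fun z => psi z * (z ^+ m)^*%C) = c m * (znorm2 m)%:C%C.
  have [i5 e5] := wint_moment alpha1 m.
  have [i6 e6] := wintZ (c m) i5.
  (* The remainder [|z|^(2 m) z t] is integrable as a difference of two integrable functions; no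
     bound on [t] near the circle is at hand. *)
  have [i7 _] := wintZ (-1) i6.
  have [i8 _] := wintD i4 i7.
  have e : (fun z => psi z * (z ^+ m)^*%C + -1 * (c m * (z * z^*%C) ^+ m)) =
      fun z => (z * z^*%C) ^+ m * (z * t z).
    by apply/funext => z; rewrite eq et !exprMn rmorphXn; ring.
  have o5 := wI_orth alpha1 ht; have {}o5 := o5 m.
  rewrite e in i8; have {}o5 := o5 i8.
  have [_ e9] := wintD i6 i8.
  rewrite o5 addr0 e6 e5 in e9; rewrite -e9; apply: wI_ext => z _.
  by rewrite eq et !exprMn rmorphXn; ring.
rewrite binnerE.
have [k1 l1] := wintZ (a * a^*%C) i1; have [k2 l2] := wintZ (b * a^*%C) i2.
have [k3 l3] := wintZ (b * b^*%C) i3; have [k4 l4] := wintZ (a * b^*%C) i4.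
have [k5 l5] := wintD k1 k2; have [k6 l6] := wintD k3 k4.
have [_ l7] := wintD k5 k6.
rewrite -mulrA -o4 -[RHS]add0r.
rewrite l5 l6 l1 l2 l3 l4 o1 o2 o3 !mulr0 !add0r in l7.
rewrite add0r -l7; apply: wI_ext => z _.
by rewrite /wcomp J1 rmorphD rmorphM /=; ring.
Qed.

End NumericalRange.

(** * From the Gamma quotient to a unit vector, and the conclusion *)

Section Radius.
Variable R : realType.

Lemma znorm2_gt0 (alpha : R) j : -1 < alpha -> 0 < znorm2 alpha j.
Proof.
move=> a1; rewrite /znorm2 mulr_gt0 ?wcst_gt0//.
have h := moment_prod j a1; have m0 := moment0_gt0 a1.
have p0 : 0 < \prod_(k < j) (alpha + k.+2%:R).
  by apply: prodr_gt0 => k _; rewrite -natr1 -natr1; have := ler0n R k; lra.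
by rewrite -(pmulr_lgt0 _ p0) h mulr_gt0// ltr0n fact_gt0.
Qed.

(** The moment recurrence and the functional equation of [Gamma] produce the same product over
    [j < m]. The identity is kept free of quotients, as [Gamma] is only known to be nonnegative. *)
Lemma znorm2_Gamma (alpha : R) m : -1 < alpha ->
  znorm2 alpha m * Gamma (m%:R + alpha + 2) = m`!%:R * Gamma (alpha + 2) * znorm2 alpha 0.
Proof.
move=> a1; rewrite -addrA Gamma_prod; last by lra.
have -> : \prod_(j < m) (alpha + 2 + j%:R) = \prod_(j < m) (alpha + j.+2%:R).
  by apply: eq_bigr => j _; rewrite -addrA -natrD add2n.
have h := moment_prod m a1; rewrite /znorm2.
transitivity (wcst alpha * Gamma (alpha + 2) *
  (moment alpha m * \prod_(j < m) (alpha + j.+2%:R))); first by ring.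
by rewrite h; ring.
Qed.

(** The conclusion is the form in which [two_mode_point] uses the bound: it makes the discriminant
    of the quadratic solved there nonnegative. *)
Lemma radius_le (alpha : R) m (x : R) : -1 < alpha -> 0 <= x ->
  x <= (m`!%:R * Gamma (alpha + 2)) /
    (Gamma (m%:R + alpha + 2) + m`!%:R * Gamma (alpha + 2)) ->
  4 * (x ^+ 2 * znorm2 alpha 0) <= znorm2 alpha m.
Proof.
move=> a1 x0; have := znorm2_Gamma m a1.
have := znorm2_gt0 m a1; have := znorm2_gt0 0 a1.
set N0 := znorm2 alpha 0; set N := znorm2 alpha m.
set B := Gamma (m%:R + _ + _); set A := _ * Gamma _ => N00 N1 e.
have : 0 <= A by rewrite mulr_ge0 ?Gamma_ge0.
(* If the numerator [A] is 0, the bound forces [x = 0]; otherwise division by [A] is possible and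
   the quotient becomes [N / (N0 + N)]. *)
rewrite le_eqVlt => /predU1P[<-|A0].
  rewrite mul0r => x1; have -> : x = 0 by lra.
  by rewrite expr0n /= mul0r mulr0 ltW.
have -> : A / (B + A) = N / (N0 + N).
  have -> : B = A * N0 / N by rewrite -e; field; rewrite gt_eqF.
  have -> : A * N0 / N + A = A * (N0 + N) / N by field; rewrite gt_eqF.
  by field; rewrite !gt_eqF// addr_gt0.
have NN : 0 < N0 + N by lra.
rewrite ler_pdivlMr// => h; rewrite -(ler_pM2r N1).
have h2 : (x * (N0 + N)) ^+ 2 <= N ^+ 2.
  apply: lerXn2r; rewrite ?nnegrE//; [exact: mulr_ge0 x0 (ltW NN)|exact: ltW].
(* AM-GM: [4 N0 N <= (N0 + N)^2] *)
rewrite -[leRHS]expr2; apply: le_trans h2.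
rewrite -subr_ge0 (_ : _ - _ = (x * (N0 - N)) ^+ 2) ?sqr_ge0//; ring.
Qed.

(* [N0 a^2 = t] solves [t + x^2 N0 / (N t) = 1]. *)
Lemma two_mode_point (N0 N x : R) : 0 < N0 -> 0 < N -> 4 * (x ^+ 2 * N0) <= N ->
  exists a : R, 0 < a /\ a ^+ 2 * N0 + (x / (a * N)) ^+ 2 * N = 1.
Proof.
move=> N00 N1 h; pose q := x ^+ 2 * N0 / N.
have q4 : 4 * q <= 1 by rewrite /q mulrA ler_pdivrMr// mul1r.
pose s := Num.sqrt (1 - 4 * q); have s0 : 0 <= s by rewrite sqrtr_ge0.
have s2 : s ^+ 2 = 1 - 4 * q by rewrite sqr_sqrtr//; lra.
(* The larger root of [t^2 - t + q = 0]: the smaller one is 0 when [x = 0], whereas [a] has to be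
   positive. *)
pose t := (1 + s) / 2; have t0 : 0 < t by rewrite /t; lra.
have tq : t ^+ 2 + q = t by rewrite /t; move: s2; rewrite !expr2; lra.
exists (Num.sqrt (t / N0)); split; first by rewrite sqrtr_gt0 divr_gt0.
rewrite expr_div_n exprMn sqr_sqrtr; last by rewrite divr_ge0 ?ltW.
have -> : t / N0 * N0 + x ^+ 2 / (t / N0 * N ^+ 2) * N = t + q / t.
  by rewrite /q; field; rewrite !gt_eqF.
apply: (@mulIf _ t); first by rewrite gt_eqF.
by rewrite mulrDl divfK ?gt_eqF// mul1r -expr2.
Qed.

End Radius.

Theorem theorem5p1 (R : realType) (alpha : R) (phi psi : R[i] -> R[i])
    (m : nat) (c : nat -> R[i]) (r : R) :
  -1 < alpha ->
  analytic_on (@udisc R) phi ->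
  (forall z, udisc z -> udisc (phi z)) ->
  phi 0 = 0 ->
  analytic_on (@udisc R) psi ->
  (0 < m)%N ->
  0 < r ->
  (forall z, cmod z < r -> series_to c 0 z (psi z)) ->
  (forall k, (k < m)%N -> c k = 0) ->
  c m != 0 ->
  wcomp_bounded alpha psi phi ->
  [set z | cmod z <=
     (m`!%:R * Gamma (alpha + 2))
       / (Gamma (m%:R + alpha + 2) + m`!%:R * Gamma (alpha + 2)) * cmod (c m)]
  `<=` numrange_wcomp alpha psi phi.
Proof.
move=> a1 aphi _ phi0 apsi m0 r0 psic c0 cm0 bdd w /= wr.
have cm : 0 < cmod (c m) by rewrite cmod_gt0.
pose x := cmod w / cmod (c m).
have x0 : 0 <= x by rewrite divr_ge0 ?cmod_ge0.
have xr := radius_le a1 x0 (etrans (ler_pdivrMr _ _ cm) wr).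
have N1 := znorm2_gt0 m a1.
have [a [a0 an]] := two_mode_point (znorm2_gt0 0 a1) N1 xr.
(* Solved from [a conj(b) c_m N_m = w] with [a] real; its modulus is [x / (a N_m)], so
   [two_mode_point] is exactly the normalisation. *)
pose b : R[i] := (w / (c m * (a * znorm2 alpha m)%:C%C))^*%C.
exists (fun z => a%:C%C + b * z ^+ m).
  split; first exact: bergman_binomial.
  rewrite bnorm2_binomial//; congr EFin; rewrite -an cmod_real gtr0_norm//.
  congr (_ + _ ^+ 2 * _); rewrite /b.
  have cJ (z : R[i]) : cmod (z^*%C) = cmod z by case: z => u v; rewrite !cmodE /= sqrrN.
  rewrite cJ cmodM cmodV cmodM cmod_real (gtr0_norm (mulr_gt0 a0 N1)).
  by rewrite /x invfM mulrA.
have sc : series_near0 c psi by exists r.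
rewrite (binner_wcomp_binomial a1 (a%:C)%C b aphi phi0 apsi sc m0 c0 bdd).
rewrite /b conjcK rmorphM /=.
have an0 : (a%:C)%C != 0 :> R[i] by rewrite -cmod_gt0 cmod_real normr_gt0 gt_eqF.
have nn0 : ((znorm2 alpha m)%:C)%C != 0 :> R[i] by rewrite -cmod_gt0 cmod_real normr_gt0 gt_eqF.
by field; rewrite cm0 an0 nn0.
Qed.
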